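(* Let $(M^n,h)$ and $(L^k,g)$ be oriented Riemannian manifolds, not necessarily compact, with $n\ge k\ge2$. Let $\alpha\in\Omega^{n-k}(M)$ be a calibration and let $u\colon(M,h)\to(L,g)$ be a Smith submersion with respect to $\alpha$. If $d\alpha=0$, then $u$ is $k$-harmonic in the sense that its $k$-tension vanishes: $$\tau_k(u)=\operatorname{div}(|du|^{k-2}du)=0\in\Gamma(u^*TL).$$
   Context: A form $\alpha\in\Omega^{m}(M)$ is a calibration if $|\alpha(e_1,\dots,e_m)|\le1$ for all orthonormal $e_1,\dots,e_m\in T_xM$, $x\in M$. $|du|^2=\operatorname{tr}_h(u^*g)$. A smooth surjection $u\colon(M^n,h)\to(L^k,g)$ is a Smith submersion with respect to $\alpha\in\Omega^{n-k}(M)$ if $\alpha\wedge u^*\mathrm{vol}_L=\frac{1}{(\sqrt k)^k}|du|^k\,\mathrm{vol}_M$ at all points of $M$; this automatically implies that at each point where $du\ne0$, $du$ has rank $k$ and $u^*g=\frac1k|du|^2h^{(0,2)}$, where $h^{(0,2)}$ is the restriction of $h$ to $(\ker du)^\perp$ extended by zero on $\ker du$ ($du$ may vanish at some points). For a section $A$ of $T^*M\otimes u^*TL$, $\operatorname{div}A=\sum_i(\nabla_{e_i}A)(e_i)$, with $(e_i)$ a local $h$-orthonormal frame and $\nabla$ the connection induced by the Levi-Civita connection of $M$ and the pullback of the Levi-Civita connection of $L$. *)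

(* Defs.v *)
From HB Require Import structures.
From mathcomp Require Export all_boot all_order all_algebra.
From mathcomp Require Export all_fingroup.
From mathcomp Require Export all_classical all_reals all_analysis.
Set Implicit Arguments.
Unset Strict Implicit.
Unset Printing Implicit Defensive.
Export numFieldNormedType.Exports.
Export Order.TTheory GRing.Theory Num.Theory.
#[global] Open Scope classical_set_scope.
#[global] Open Scope ring_scope.

(* Tangent vectors are row vectors of chart components, and a tuple of p      *)
(* tangent vectors is the p x n matrix V of its rows, so a linear map with    *)
(* (row-convention) Jacobian J sends V to V *m J.                             *)

(* C^oo on the open set U: every iterated partial derivative is               *)
(* differentiable (hence continuous) at every point of U.                     *)
Definition smooth_on (R : realType) (n : nat) (W : normedModType R)
    (U : set 'rV[R]_n) (f : 'rV[R]_n -> W) : Prop :=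
  forall (s : seq 'I_n) (y : 'rV[R]_n), U y ->
    differentiable
      (foldr (fun (a : 'I_n) (d : 'rV[R]_n -> W) =>
                fun z => 'D_(delta_mx 0 a) d z) f s) y.

(* A smooth manifold without boundary, with an oriented atlas: the transition *)
(* maps are smooth with positive Jacobian determinant.  coord i and param i   *)
(* are total functions of which only the restrictions to dom i and            *)
(* coord i @` dom i are relevant.                                             *)
Record oriented_manifold (R : realType) (n : nat) := OrientedManifold {
  points :> topologicalType;
  chart : Type;
  dom : chart -> set points;
  coord : chart -> points -> 'rV[R]_n;
  param : chart -> 'rV[R]_n -> points;
  manifold_hausdorff : hausdorff_space points;
  manifold_second_countable : @second_countable points;
  dom_cover : forall x, exists i, dom i x;
  dom_open : forall i, open (dom i);
  img_open : forall i, open (coord i @` dom i);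
  coordK : forall i x, dom i x -> param i (coord i x) = x;
  coord_continuous : forall i x, dom i x -> {for x, continuous (coord i)};
  param_continuous : forall i y, (coord i @` dom i) y ->
    {for y, continuous (param i)};
  transition_smooth : forall i j,
    smooth_on (coord i @` (dom i `&` dom j)) (coord j \o param i);
  transition_oriented : forall i j x, dom i x -> dom j x ->
    0 < \det (jacobian (coord j \o param i) (coord i x))
}.

Arguments chart {R n} o.
Arguments dom {R n o} i.
Arguments coord {R n o} i x.
Arguments param {R n o} i y.

Section Tensors.
Variables (R : realType) (n : nat) (M : oriented_manifold R n).

Definition transition (i j : chart M) (x : M) : 'M[R]_n :=
  jacobian (coord j \o param i) (coord i x).

(* metric_mx i x is the Gram matrix of the metric at x in the coordinate      *)
(* basis of the chart i.                                                      *)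
Record riemannian_metric := RiemannianMetric {
  metric_mx :> chart M -> M -> 'M[R]_n;
  metric_sym : forall i x, dom i x -> (metric_mx i x)^T = metric_mx i x;
  metric_posdef : forall i x, dom i x -> forall v : 'rV[R]_n, v != 0 ->
    0 < (v *m metric_mx i x *m v^T) 0 0;
  metric_smooth : forall i,
    smooth_on (coord i @` dom i) (metric_mx i \o param i);
  metric_transition : forall i j x, dom i x -> dom j x ->
    metric_mx i x = transition i j x *m metric_mx j x *m (transition i j x)^T
}.

Definition multilinear_form (p : nat) (a : 'M[R]_(p, n) -> R) : Prop :=
  forall (V V1 V2 : 'M[R]_(p, n)) (l : 'I_p) (b c : R),
    row l V = b *: row l V1 + c *: row l V2 ->
    row' l V1 = row' l V -> row' l V2 = row' l V ->
    a V = b * a V1 + c * a V2.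

Definition alternating_form (p : nat) (a : 'M[R]_(p, n) -> R) : Prop :=
  forall (V : 'M[R]_(p, n)) (l m : 'I_p),
    l != m -> row l V = row m V -> a V = 0.

Record diff_form (p : nat) := DiffForm {
  form_val :> chart M -> M -> 'M[R]_(p, n) -> R;
  form_multilinear : forall i x, dom i x -> multilinear_form (form_val i x);
  form_alternating : forall i x, dom i x -> alternating_form (form_val i x);
  form_smooth : forall i (V : 'M[R]_(p, n)),
    smooth_on (coord i @` dom i) (fun y => form_val i (param i y) V);
  form_transition : forall i j x, dom i x -> dom j x ->
    forall V : 'M[R]_(p, n), form_val i x V = form_val j x (V *m transition i j x)
}.

(* (d alpha)(v_0, ..., v_p)
     = sum_l (-1)^l D_(v_l) (alpha(v_0, ..., omit v_l, ..., v_p))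
   in the chart i.                                                            *)
Definition ext_deriv (p : nat) (alpha : diff_form p) (i : chart M) (x : M)
    (V : 'M[R]_(p.+1, n)) : R :=
  \sum_(l < p.+1)
     (-1) ^+ l * 'D_(row l V) (fun y => alpha i (param i y) (row' l V)) (coord i x).

Definition closed_form (p : nat) (alpha : diff_form p) : Prop :=
  forall (i : chart M) (x : M), dom i x ->
  forall V : 'M[R]_(p.+1, n), ext_deriv alpha i x V = 0.

Definition volume_form (h : riemannian_metric) (i : chart M) (x : M)
    (V : 'M[R]_n) : R :=
  Num.sqrt (\det (h i x)) * \det V.

Definition orthonormal_family (h : riemannian_metric) (i : chart M) (x : M)
    (p : nat) (E : 'M[R]_(p, n)) : Prop :=
  E *m h i x *m E^T = 1%:M.

Definition calibration (h : riemannian_metric) (p : nat) (alpha : diff_form p) :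
    Prop :=
  forall (i : chart M) (x : M), dom i x ->
  forall E : 'M[R]_(p, n), orthonormal_family h i x E -> `|alpha i x E| <= 1.

(* The Levi-Civita connection in the chart i: the covariant derivative along  *)
(* v of the vector field with constant components w has components            *)
(* Gamma(v, w), where                                                         *)
(*   2 h(Gamma(v, w), z) = D_v h(w, z) + D_w h(v, z) - D_z h(v, w).           *)
Definition christoffel (h : riemannian_metric) (i : chart M) (x : M)
    (v w : 'rV[R]_n) : 'rV[R]_n :=
  let Dh (z : 'rV[R]_n) : 'M[R]_n := 'D_z (h i \o param i) (coord i x) in
  (2^-1 *: (w *m Dh v + v *m Dh w
            - \row_c (v *m Dh (delta_mx 0 c) *m w^T) 0 0)) *m invmx (h i x).

End Tensors.

(* Normalized so that the wedge of the dual basis covectors is 1 on the basis. *)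
Definition wedge_form (R : realType) (n p q : nat)
    (a : 'M[R]_(p, n) -> R) (b : 'M[R]_(q, n) -> R) (V : 'M[R]_(p + q, n)) : R :=
  ((p`! * q`!)%N%:R)^-1 *
  \sum_(s : 'S_(p + q))
     (-1) ^+ s * a (usubmx (row_perm s V)) * b (dsubmx (row_perm s V)).

Section Maps.
Variables (R : realType) (n k : nat).
Variables (M : oriented_manifold R n) (L : oriented_manifold R k).
Variables (h : riemannian_metric M) (g : riemannian_metric L).

Definition smooth_map (u : M -> L) : Prop :=
  continuous u /\
  forall (i : chart M) (j : chart L),
    smooth_on (coord i @` (dom i `&` u @^-1` dom j)) (coord j \o u \o param i).

Definition differential (u : M -> L) (i : chart M) (j : chart L) (x : M) :
    'M[R]_(n, k) :=
  jacobian (coord j \o u \o param i) (coord i x).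

Definition pullback_metric (u : M -> L) (i : chart M) (j : chart L) (x : M) :
    'M[R]_n :=
  differential u i j x *m g j (u x) *m (differential u i j x)^T.

Definition norm_du (u : M -> L) (i : chart M) (j : chart L) (x : M) : R :=
  Num.sqrt (\tr (invmx (h i x) *m pullback_metric u i j x)).

Definition smith_submersion (p : nat) (pkn : (p + k)%N = n)
    (alpha : diff_form M p) (u : M -> L) : Prop :=
  [/\ smooth_map u,
      forall y : L, exists x : M, u x = y
    & forall (i : chart M) (j : chart L) (x : M), dom i x -> dom j (u x) ->
      forall V : 'M[R]_n,
        wedge_form (alpha i x)
          (fun W => volume_form g j (u x) (W *m differential u i j x))
          (castmx (esym pkn, erefl n) V)
        = (Num.sqrt k%:R ^+ k)^-1 * norm_du u i j x ^+ k * volume_form h i x V].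

(* (nabla_v A)(w) for a section A of T*M (x) u*TL, given by its n x k matrices *)
(* of components in the charts i of M and j of L.                             *)
Definition cov_deriv (u : M -> L) (A : chart M -> chart L -> M -> 'M[R]_(n, k))
    (i : chart M) (j : chart L) (x : M) (v w : 'rV[R]_n) : 'rV[R]_k :=
  w *m 'D_v (A i j \o param i) (coord i x)
  - christoffel h i x v w *m A i j x
  + christoffel g j (u x) (v *m differential u i j x) (w *m A i j x).

(* The divergence computed in a frame with rows E, in the charts i and j.     *)
Definition divergence (u : M -> L) (A : chart M -> chart L -> M -> 'M[R]_(n, k))
    (i : chart M) (j : chart L) (x : M) (E : 'M[R]_n) : 'rV[R]_k :=
  \sum_(l < n) cov_deriv u A i j x (row l E) (row l E).

(* For smooth u and k >= 2 the section |du|^(k-2) du is C^1 also where        *)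
(* du = 0: for k = 2 it is du (0 ^+ 0 = 1), and for k > 2 it is               *)
(* O(|du|^(k-1)).  So the derivatives in its divergence exist everywhere.     *)
Definition k_tension (u : M -> L) (i : chart M) (j : chart L) (x : M)
    (E : 'M[R]_n) : 'rV[R]_k :=
  divergence u
    (fun i j z => norm_du u i j z ^+ (k - 2) *: differential u i j z) i j x E.

Definition k_harmonic (u : M -> L) : Prop :=
  forall (i : chart M) (j : chart L) (x : M), dom i x -> dom j (u x) ->
  forall E : 'M[R]_n, orthonormal_family h i x E -> k_tension u i j x E = 0.

End Maps.

(* Main.v *)
From mathcomp Require Import ring zify.
Require Import Defs.
Set Implicit Arguments.
Unset Strict Implicit.
Unset Printing Implicit Defensive.

(* Write J for the differential of u in charts and |J| for its norm.  For every
   n x k matrix F, the calibration inequality in an orthonormal frame adapted to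
   F, together with the inequality between the geometric and the arithmetic
   mean, gives
     |alpha /\ F^* vol_L| <= k^(-k/2) |F|^k vol_M.
   A Smith submersion realizes equality at F = J, so both sides have the same
   derivative in F at J.  This "first cousin" identity says that
     |J|^(k-2) h^-1 J g,
   up to the factor sqrt(det g / det h) and a constant, is the matrix Psi of
   cofactors of alpha /\ F^* vol_L at F = J; it holds where J = 0 as well, since
   k >= 2.  In particular |J|^(k-2) J is differentiable everywhere.  Pairing the
   identity with J shows that J is conformal on the orthogonal of its kernel.
   The columns of Psi are the (n-1)-forms alpha /\ du^1 .. (omit du^c) .. du^k,
   which are closed because d alpha = 0 and second derivatives commute; hence
   Psi is divergence free.  Differentiating the identity and contracting, the
   Christoffel symbols of h and of g (the latter by conformality) cancel. *)

(** * Multilinear and alternating forms on tuples of rows *)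

Section MultilinearForms.
Variables (R : realType) (n : nat).

Lemma row'_eqP (m : nat) (l : 'I_m) (V W : 'M[R]_(m, n)) :
  row' l V = row' l W <-> (forall i j, i != l -> V i j = W i j).
Proof.
split=> [/matrixP e i j|e]; last first.
  by apply/matrixP => i j; rewrite !mxE e// eq_sym neq_lift.
rewrite eq_sym => /unlift_some[i' -> _].
by have := e i' j; rewrite !mxE.
Qed.

Definition set_row (m : nat) (l : 'I_m) (v : 'rV[R]_n) (V : 'M[R]_(m, n)) :
    'M[R]_(m, n) := \matrix_(i, j) if i == l then v 0 j else V i j.

Lemma set_row_id (m : nat) (l : 'I_m) (V : 'M[R]_(m, n)) :
  set_row l (row l V) V = V.
Proof. by apply/matrixP => i j; rewrite !mxE; case: eqP => [->|]. Qed.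

Lemma set_rowC (m : nat) (l l' : 'I_m) v w (V : 'M[R]_(m, n)) : l != l' ->
  set_row l v (set_row l' w V) = set_row l' w (set_row l v V).
Proof.
move=> ll'; apply/matrixP => i j; rewrite !mxE.
by case: eqP => [->|//]; rewrite (negPf ll').
Qed.

Section Form.
Variables (p : nat) (a : 'M[R]_(p, n) -> R).
Hypothesis aM : multilinear_form a.

Lemma multilinear_set_row l b c v w V :
  a (set_row l (b *: v + c *: w) V) = b * a (set_row l v V) + c * a (set_row l w V).
Proof.
apply: (aM (l := l)).
- by apply/rowP => j; rewrite !mxE eqxx.
- by apply/row'_eqP => i j /negPf il; rewrite !mxE il.
- by apply/row'_eqP => i j /negPf il; rewrite !mxE il.
Qed.

Lemma multilinear_set_row0 l V : a (set_row l 0 V) = 0.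
Proof.
by have := multilinear_set_row l 0 0 0 0 V; rewrite !scale0r addr0 !mul0r addr0.
Qed.

Lemma multilinear_set_rowD l v w V :
  a (set_row l (v + w) V) = a (set_row l v V) + a (set_row l w V).
Proof. by have := multilinear_set_row l 1 1 v w V; rewrite !scale1r !mul1r. Qed.

Lemma multilinear_set_rowZ l b v V : a (set_row l (b *: v) V) = b * a (set_row l v V).
Proof.
by have := multilinear_set_row l b 0 v 0 V; rewrite scale0r addr0 mul0r addr0.
Qed.

Lemma multilinear_row_sum l V :
  a V = \sum_j V l j * a (set_row l (delta_mx 0 j) V).
Proof.
rewrite -[in LHS](set_row_id l V) (row_sum_delta (row l V)).
rewrite (big_morph (fun v => a (set_row l v V)) (fun v w => multilinear_set_rowD l v w V)
  (multilinear_set_row0 l V)).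
by apply: eq_bigr => j _; rewrite multilinear_set_rowZ mxE.
Qed.

Hypothesis aA : alternating_form a.

(** Polarization: with the sum of both rows in each of the two slots the value is 0, and expanding
    it leaves the two mixed terms. *)
Lemma alternating_tperm l l' V : l != l' ->
  a (row_perm (tperm l l') V) = - a V.
Proof.
move=> ll'; pose W v w := a (set_row l v (set_row l' w V)).
have W0 v : W v v = 0.
  apply: (aA ll'); apply/rowP => j; rewrite !mxE !eqxx.
  by rewrite eq_sym (negPf ll').
have WDl v w z : W (v + w) z = W v z + W w z by rewrite /W multilinear_set_rowD.
have WDr v w z : W z (v + w) = W z v + W z w.
  by rewrite /W !(set_rowC _ _ _ ll') multilinear_set_rowD.
have E1 : V = set_row l (row l V) (set_row l' (row l' V) V).
  by rewrite !set_row_id.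
have E2 : row_perm (tperm l l') V = set_row l (row l' V) (set_row l' (row l V) V).
  apply/matrixP => i j; rewrite !mxE.
  case: tpermP => [->|->|/eqP/negPf-> /eqP/negPf->//]; rewrite ?eqxx//.
  by rewrite eq_sym (negPf ll').
rewrite [in RHS]E1 E2.
apply/eqP; rewrite -addr_eq0; apply/eqP.
have := W0 (row l V + row l' V).
by rewrite WDl !WDr !W0 add0r addr0 addrC.
Qed.

Lemma alternating_row_perm (s : 'S_p) V : a (row_perm s V) = (-1) ^+ s * a V.
Proof.
have [ts -> ats] := prod_tpermP s; elim: ts ats => [|[i j] ts IH] /=.
  by move=> _; rewrite big_nil row_perm1 odd_perm1 mul1r.
move=> /andP[ij ats]; rewrite big_cons row_permM alternating_tperm// IH//.
by rewrite odd_mul_tperm ij signr_addb expr1 mulN1r mulNr.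
Qed.

End Form.

(** Rows are expanded in the standard basis one after another; [main] inducts on the number [m] of
    leading rows that are still arbitrary. *)
Lemma multilinear_ext (p : nat) (a b : 'M[R]_(p, n) -> R) :
  multilinear_form a -> multilinear_form b ->
  (forall f : 'I_p -> 'I_n,
     a (\matrix_i delta_mx 0 (f i)) = b (\matrix_i delta_mx 0 (f i))) ->
  a =1 b.
Proof.
move=> aM bM ab V.
have main (m : nat) : forall W : 'M[R]_(p, n),
    (forall l : 'I_p, (m <= l)%N -> exists j, row l W = delta_mx 0 j) -> a W = b W.
  elim: m => [W Wd|m IH W Wd].
    have [f fP] := choice (fun l => Wd l (leq0n _)).
    suff -> : W = \matrix_i delta_mx 0 (f i) by exact: ab.
    by apply/row_matrixP => l; rewrite fP rowK.
  have [mp|pm] := ltnP m p; last first.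
    by apply: IH => l ml; move: (ltn_ord l); rewrite ltnNge (leq_trans pm ml).
  pose l := Ordinal mp.
  rewrite (multilinear_row_sum aM l) (multilinear_row_sum bM l).
  apply: eq_bigr => j _; congr (_ * _); apply: IH => i mi.
  have [->|il] := eqVneq i l.
    by exists j; apply/rowP => j'; rewrite !mxE !eqxx.
  have [|j' ij'] := Wd i; first by rewrite ltn_neqAle mi andbT eq_sym.
  by exists j'; rewrite -ij'; apply/rowP => c; rewrite !mxE (negPf il).
by apply: (main p) => l; rewrite leqNgt ltn_ord.
Qed.

End MultilinearForms.

Lemma multilinear_det (R : realType) (n : nat) (c : R) :
  multilinear_form (fun V : 'M[R]_n => \det V * c).
Proof.
move=> V V1 V2 l b d Vl V1l V2l.
by rewrite (determinant_multilinear Vl V1l V2l) mulrDl !mulrA.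
Qed.

(** Both sides are multilinear, so tuples of basis vectors suffice: an injective choice is a
    permutation of the basis and contributes its sign, and any other choice repeats a row, which
    gives 0 on both sides. *)
Lemma alternating_top_form (R : realType) (n : nat) (a : 'M[R]_n -> R) :
  multilinear_form a -> alternating_form a -> forall V, a V = \det V * a 1%:M.
Proof.
move=> aM aA; apply: (multilinear_ext aM); first exact: multilinear_det.
move=> f; have [/injectiveP fi|/injectivePn[i [j ij fij]]] := boolP (injectiveb f).
  have -> : \matrix_i delta_mx 0 (f i) = perm_mx (perm fi) :> 'M[R]_n.
    by apply/matrixP => i j; rewrite !mxE permE eqxx eq_sym.
  by rewrite det_perm perm_mxEsub -(alternating_row_perm aM aA); congr a;
     apply/matrixP => i j; rewrite !mxE.
have eij : row i (\matrix_i delta_mx 0 (f i)) = row j (\matrix_i delta_mx 0 (f i)) :> 'rV[R]_n.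
  by rewrite !rowK fij.
rewrite (aA _ _ _ ij eij) (determinant_alternate ij) ?mul0r//.
by move=> c; move/rowP/(_ c) : eij; rewrite !mxE.
Qed.

(** * The wedge of a form with a pulled-back determinant *)

Section WedgeWithPullback.
Variables (R : realType) (p k : nat).
Implicit Types (a : 'M[R]_(p, p + k) -> R) (F : 'M[R]_(p + k, k)).
Implicit Types (V : 'M[R]_(p + k)).

Definition rshift_perm_fun (t : 'S_k) (i : 'I_(p + k)) : 'I_(p + k) :=
  match fintype.split i with inl l => lshift k l | inr d => rshift p (t d) end.

Lemma rshift_perm_inj t : injective (rshift_perm_fun t).
Proof.
apply: (can_inj (g := rshift_perm_fun t^-1%g)) => i; rewrite /rshift_perm_fun.
by case: (split_ordP i) => [l ->|d ->]; rewrite ?(unsplitK (inl _)) ?(unsplitK (inr _)) ?permK.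
Qed.

Definition rshift_perm t : 'S_(p + k) := perm (@rshift_perm_inj t).

Lemma rshift_permL t l : rshift_perm t (lshift k l) = lshift k l.
Proof. by rewrite permE /rshift_perm_fun (unsplitK (inl _)). Qed.

Lemma rshift_permR t d : rshift_perm t (rshift p d) = rshift p (t d).
Proof. by rewrite permE /rshift_perm_fun (unsplitK (inr _)). Qed.

(** The sign is read off from the determinant of a block diagonal permutation matrix. *)
Lemma sign_rshift_perm t : (-1) ^+ rshift_perm t = (-1) ^+ t :> R.
Proof.
rewrite -!det_perm.
have -> : perm_mx (rshift_perm t) = block_mx 1%:M 0 0 (perm_mx t) :> 'M[R]_(p + k).
  apply/matrixP => i j; rewrite !mxE.
  case: (split_ordP i) => [l ->|d ->]; rewrite ?rshift_permL ?rshift_permR !mxE;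
    case: (split_ordP j) => [l' ->|d' ->].
  - by rewrite !mxE (inj_eq (@lshift_inj _ _)).
  - by rewrite !mxE eq_lrshift.
  - by rewrite !mxE eq_rlshift.
  - by rewrite !mxE (inj_eq (@rshift_inj _ _)).
by rewrite det_ublock det1 mul1r.
Qed.

(** This is p! times the wedge of [a] with the form sending [W] to [\det (W *m F)]. Of that
    determinant only the diagonal product is kept, which makes the value visibly linear in each
    column of [F]. *)
Definition wedge_pullback a F V : R :=
  \sum_(s : 'S_(p + k)) (-1) ^+ s * a (usubmx (row_perm s V)) *
     \prod_(d < k) (V *m F) (s (rshift p d)) d.

(* The permutation in the Leibniz formula of the determinant is absorbed into
   [s]. *)
Lemma wedge_form_det a F V :
  wedge_form a (fun W => \det (W *m F)) V = (p`!%:R)^-1 * wedge_pullback a F V.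
Proof.
rewrite /wedge_form natrM invfM -mulrA; congr (_ * _).
apply: (mulfI (x := k`!%:R)); first by rewrite pnatr_eq0 -lt0n fact_gt0.
rewrite mulrA mulfV ?mul1r; last by rewrite pnatr_eq0 -lt0n fact_gt0.
under eq_bigr do rewrite /determinant mulr_sumr.
rewrite exchange_big /=.
rewrite (eq_bigr (fun=> wedge_pullback a F V)); last first.
  move=> t _.
  rewrite /wedge_pullback.
  rewrite [RHS](reindex_inj (mulgI (rshift_perm t^-1%g))).
  apply: eq_bigr => s _.
  rewrite odd_permM signr_addb sign_rshift_perm odd_permV.
  have -> : usubmx (row_perm (rshift_perm t^-1 * s) V) = usubmx (row_perm s V).
    by apply/matrixP => i j; rewrite !mxE permM rshift_permL.
  rewrite (reindex_inj (@perm_inj _ t^-1%g)) /=.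
  rewrite (eq_bigr (fun d => (V *m F) ((rshift_perm t^-1 * s)%g (rshift p d)) d)).
    by rewrite mulrCA !mulrA.
  move=> d _; rewrite permM rshift_permR permKV !mxE.
  by apply: eq_bigr => j _; rewrite !mxE.
by rewrite sumr_const card_Sn mulr_natl.
Qed.

End WedgeWithPullback.

Section WedgeWithPullbackTop.
Variables (R : realType) (p k : nat).
Implicit Types (a : 'M[R]_(p, p + k) -> R) (F : 'M[R]_(p + k, k)).
Implicit Types (V : 'M[R]_(p + k)).

(** For each permutation [s], the row [l] of [V] occurs exactly once: either as an argument of [a],
    or in a single factor of the product. The two cases are treated separately. *)
Lemma multilinear_wedge_pullback a F : multilinear_form a ->
  multilinear_form (wedge_pullback a F).
Proof.
move=> aM V V1 V2 l b c Vl /row'_eqP V1l /row'_eqP V2l.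
have VF1 i d : i != l -> (V1 *m F) i d = (V *m F) i d.
  by move=> il; rewrite !mxE; apply: eq_bigr => j _; rewrite V1l.
have VF2 i d : i != l -> (V2 *m F) i d = (V *m F) i d.
  by move=> il; rewrite !mxE; apply: eq_bigr => j _; rewrite V2l.
have VFl d : (V *m F) l d = b * (V1 *m F) l d + c * (V2 *m F) l d.
  rewrite !mxE !mulr_sumr -big_split/=; apply: eq_bigr => j _.
  by move/rowP/(_ j) : Vl; rewrite !mxE => ->; rewrite mulrDl !mulrA.
rewrite /wedge_pullback !mulr_sumr -big_split/=; apply: eq_bigr => s _.
have sl : s (s^-1%g l) = l by rewrite permKV.
case: (split_ordP (s^-1%g l)) => [m|d0] ml; rewrite ml in sl.
- have sN d : s (rshift p d) != l.
    by rewrite -sl (inj_eq (@perm_inj _ s)) eq_rlshift.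
  rewrite (eq_bigr (fun d => (V *m F) (s (rshift p d)) d)
  (F1 := fun d => (V1 *m F) _ _)); last first.
    by move=> d _; rewrite VF1.
  rewrite (eq_bigr (fun d => (V *m F) (s (rshift p d)) d)
  (F1 := fun d => (V2 *m F) _ _)); last first.
    by move=> d _; rewrite VF2.
  have mN i : i != m -> s (lshift k i) != l.
    by rewrite -sl (inj_eq (@perm_inj _ s)) (inj_eq (@lshift_inj _ _)).
  rewrite (aM _ (usubmx (row_perm s V1)) (usubmx (row_perm s V2)) m b c).
  + by rewrite mulrDr mulrDl; congr (_ + _); rewrite !mulrA; congr (_ * _ * _);
      rewrite mulrC.
  + by apply/rowP => j; move/rowP/(_ j) : Vl; rewrite !mxE sl.
  + by apply/row'_eqP => i j im; rewrite !mxE V1l// mN.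
  + by apply/row'_eqP => i j im; rewrite !mxE V2l// mN.
have lN i : s (lshift k i) != l.
  by rewrite -sl (inj_eq (@perm_inj _ s)) eq_lrshift.
have -> : usubmx (row_perm s V1) = usubmx (row_perm s V).
  by apply/matrixP => i j; rewrite !mxE V1l.
have -> : usubmx (row_perm s V2) = usubmx (row_perm s V).
  by apply/matrixP => i j; rewrite !mxE V2l.
have prodE (W : 'M[R]_(p + k)) : \prod_(d < k) (W *m F) (s (rshift p d)) d =
    (W *m F) l d0 * \prod_(d < k | d != d0) (W *m F) (s (rshift p d)) d.
  by rewrite (bigD1 d0)//= sl.
rewrite !prodE VFl.
have dN d : d != d0 -> s (rshift p d) != l.
  by rewrite -sl (inj_eq (@perm_inj _ s)) (inj_eq (@rshift_inj _ _)).
rewrite (eq_bigr (fun d => (V *m F) (s (rshift p d)) d)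
  (F1 := fun d => (V1 *m F) _ _)); last first.
  by move=> d dd0; rewrite VF1// dN.
rewrite (eq_bigr (fun d => (V *m F) (s (rshift p d)) d)
  (F1 := fun d => (V2 *m F) _ _)); last first.
  by move=> d dd0; rewrite VF2// dN.
set P := \prod_(_ < _ | _) _; set A := _ * a _.
by rewrite mulrDl mulrDr; congr (_ + _); rewrite -mulrA mulrCA.
Qed.

(** The antisymmetry comes from the signed sum: reindexing it by the transposition of the two equal
    rows shows that the value equals its opposite. *)
Lemma alternating_wedge_pullback a F : alternating_form (wedge_pullback a F).
Proof.
move=> V i j ij rij.
have VE : row_perm (tperm i j) V = V.
  apply/row_matrixP => l; apply/rowP => c; rewrite !mxE.
  case: tpermP => [->|->|//].
  - by move/rowP/(_ c) : rij; rewrite !mxE.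
  - by move/rowP/(_ c) : rij; rewrite !mxE.
apply/eqP; rewrite -[_ == 0](@mulrn_eq0 R _ 2) mulr2n addr_eq0; apply/eqP.
rewrite {1}/wedge_pullback (reindex_inj (mulIg (tperm i j))) /= -sumrN.
apply: eq_bigr => s _.
rewrite row_permM VE odd_permM odd_tperm ij signr_addb expr1 mulrN1 !mulNr.
congr (- (_ * _)); apply: eq_bigr => d _; rewrite permM.
by rewrite -[in RHS]VE row_permE -mulmxA -row_permE !mxE.
Qed.

(** A form of top degree is a multiple of the determinant. This allows the value at the coordinate
    frame to be computed in an adapted one. *)
Lemma wedge_pullback_top a F V : multilinear_form a ->
  wedge_pullback a F V = \det V * wedge_pullback a F 1%:M.
Proof.
move=> aM; apply: alternating_top_form.
  exact: multilinear_wedge_pullback.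
exact: alternating_wedge_pullback.
Qed.

(** Once the sum is written with determinants again, every term carries the factor [\det C]. *)
Lemma wedge_pullback_mulr a F (C : 'M[R]_k) V :
  wedge_pullback a (F *m C) V = \det C * wedge_pullback a F V.
Proof.
have p0 : (p`!%:R)^-1 != 0 :> R by rewrite invr_eq0 pnatr_eq0 -lt0n fact_gt0.
apply: (mulfI p0); rewrite mulrCA -!wedge_form_det /wedge_form mulrCA; congr (_ * _).
rewrite mulr_sumr; apply: eq_bigr => s _.
by rewrite mulmxA det_mulmx mulrA mulrC.
Qed.

End WedgeWithPullbackTop.

(** * Positive definite matrices and adapted frames *)

Definition posdef_mx (R : realType) (n : nat) (h : 'M[R]_n) : Prop :=
  h^T = h /\ forall v : 'rV[R]_n, v != 0 -> 0 < (v *m h *m v^T) 0 0.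

(** Rows are chosen one at a time as in Gram-Schmidt, so that [E *m F] is zero outside a lower
    triangular block in its last [k] rows. That shape will leave a single product of diagonal
    entries in the wedge. *)
Lemma adapted_frame (R : realType) (p k : nat) (h : 'M[R]_(p + k))
    (F : 'M[R]_(p + k, k)) : posdef_mx h ->
  exists E : 'M[R]_(p + k), E *m h *m E^T = 1%:M /\
    forall (r : 'I_(p + k)) (d : 'I_k), (r < p + d)%N -> (E *m F) r d = 0.
Proof.
move=> [hT hpos].
have main (m : nat) : (m <= p + k)%N -> exists E : 'M[R]_(p + k),
    (forall r s : 'I_(p + k), (r < m)%N -> (s < m)%N ->
       (E *m h *m E^T) r s = (r == s)%:R) /\
    (forall (r : 'I_(p + k)) (d : 'I_k), (r < m)%N -> (r < p + d)%N ->
       (E *m F) r d = 0).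
  elim: m => [_|m IH mpk]; first by exists 0; split.
  have [E [Eh EF]] := IH (ltnW mpk); pose l := Ordinal mpk.
  (* The new vector [v] must satisfy [n - 1] linear equations; they are the
     columns of [B], whose column [l] is free. *)
  pose B : 'M[R]_(p + k) := \matrix_(i, s)
    if (s < m)%N then (h *m E^T) i s
    else if s == l then 0
    else match fintype.split s with inl _ => 0 | inr d => F i d end.
  have : \det B == 0.
    rewrite (expand_det_col _ l) big1// => i _.
    by rewrite !mxE ltnn eqxx mul0r.
  case/det0P => v v0 vB.
  have q0 := hpos _ v0; set q := (v *m h *m v^T) 0 0 in q0.
  pose w := (Num.sqrt q)^-1 *: v.
  have ww : (w *m h *m w^T) 0 0 = 1.
    rewrite /w linearZ/= -!scalemxAl -scalemxAr scalerA !mxE -/q.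
    have -> : \sum_j (v *m h) 0 j * v^T j 0 = q by rewrite /q mxE.
    rewrite -invfM -expr2 sqr_sqrtr ?ltW// mulVf//; exact: lt0r_neq0.
  have wB : w *m B = 0 by rewrite /w -scalemxAl vB scaler0.
  have wE (s : 'I_(p + k)) : (s < m)%N -> (w *m h *m E^T) 0 s = 0.
    move=> sm; move/rowP/(_ s) : wB; rewrite -mulmxA [in RHS]mxE => <-.
    by rewrite !mxE; apply: eq_bigr => j _; rewrite [B _ _]mxE sm.
  have wF (d : 'I_k) : (m < p + d)%N -> (w *m F) 0 d = 0.
    move=> md; move/rowP/(_ (rshift p d)) : wB; rewrite [in RHS]mxE => <-.
    rewrite !mxE; apply: eq_bigr => j _; rewrite [B _ _]mxE /=.
    rewrite ltnNge (ltnW md)/= (unsplitK (inr _)) ifF//.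
    by apply/negP => /eqP/(congr1 val)/= e; rewrite e ltnn in md.
  pose E' := set_row l w E.
  have E'l : row l E' = w by apply/rowP => j; rewrite !mxE eqxx.
  have E'N r : r != l -> row r E' = row r E.
    by move=> /negPf rl; apply/rowP => j; rewrite !mxE rl.
  have gramE (X : 'M[R]_(p + k)) r s :
      (X *m h *m X^T) r s = (row r X *m h *m (row s X)^T) 0 0.
    by rewrite -row_mul !mxE; apply: eq_bigr => j _; rewrite !mxE.
  have gramC (v1 v2 : 'rV[R]_(p + k)) :
      (v1 *m h *m v2^T) 0 0 = (v2 *m h *m v1^T) 0 0.
    rewrite -[in LHS](trmxK (v1 *m h *m v2^T)) [in LHS]mxE.
    by rewrite !trmx_mul trmxK hT mulmxA.
  have wEs (s : 'I_(p + k)) : (s < m)%N -> (w *m h *m (row s E)^T) 0 0 = 0.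
    by move=> /wE <-; rewrite !mxE; apply: eq_bigr => j _; rewrite !mxE.
  have ltS (r : 'I_(p + k)) : (r < m.+1)%N -> r != l -> (r < m)%N.
    by rewrite ltnS leq_eqVlt => /orP[/eqP e /eqP[]|//]; exact: val_inj.
  exists E'; split=> [r s rm sm|r d rm rd].
    rewrite gramE; have [->|rl] := eqVneq r l; have [->|sl] := eqVneq s l.
    - by rewrite E'l ww.
    - by rewrite E'l E'N// wEs// ltS.
    - by rewrite E'l E'N// gramC wEs ?ltS// (negPf rl).
    - by rewrite !E'N// -gramE Eh ?ltS.
  have -> : (E' *m F) r d = (row r E' *m F) 0 d by rewrite -row_mul [in RHS]mxE.
  have [rl|rl] := eqVneq r l.
    by rewrite rl E'l wF//; move: rd; rewrite rl.
  by rewrite E'N// -row_mul mxE EF// ltS.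
have [E [Eh EF]] := main _ (leqnn _).
exists E; split=> [|r d rd]; last exact: EF.
by apply/matrixP => r s; rewrite Eh// mxE.
Qed.

(** For p = 0 and F = 0 an adapted frame is just an orthonormal frame, and [C] is its inverse. *)
Lemma posdef_factor (R : realType) (n : nat) (g : 'M[R]_n) : posdef_mx g ->
  exists2 C, C \in unitmx & g = C *m C^T.
Proof.
move=> gP; have [G [Gg _]] := @adapted_frame R 0 n g 0 gP.
have [Gu _] := mulmx1_unit Gg; rewrite unitmx_mul in Gu; case/andP: Gu => Gu _.
exists (invmx G : 'M[R]_n); first by rewrite unitmx_inv.
have : invmx G *m (G *m g *m G^T) *m (invmx G)^T = invmx G *m (invmx G)^T.
  by rewrite Gg mulmx1.
by rewrite !mulmxA mulVmx// mul1mx -mulmxA -trmx_mul mulVmx// trmx1 mulmx1.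
Qed.

Lemma posdef_det_gt0 (R : realType) (n : nat) (g : 'M[R]_n) : posdef_mx g ->
  0 < \det g.
Proof.
move=> /posdef_factor[C Cu ->]; rewrite det_mulmx det_tr -expr2.
by rewrite exprn_even_gt0//= -unitfE -unitmxE.
Qed.

Lemma posdef_unitmx (R : realType) (n : nat) (g : 'M[R]_n) : posdef_mx g ->
  g \in unitmx.
Proof. by move=> /posdef_det_gt0 /lt0r_neq0; rewrite unitmxE unitfE. Qed.

Lemma mxtrace_mulmx_trmx (R : realType) (m n : nat) (A : 'M[R]_(m, n)) :
  \tr (A *m A^T) = \sum_i \sum_j A i j ^+ 2.
Proof.
by apply: eq_bigr => i _; rewrite mxE; apply: eq_bigr => j _; rewrite mxE expr2.
Qed.

(** * The calibration inequality *)

Section CalibrationBound.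
Variables (R : realType) (p k : nat).
Implicit Types (a : 'M[R]_(p, p + k) -> R) (F : 'M[R]_(p + k, k)).

(** A permutation that lowers none of the last [k] indices must fix the largest one, then the next
    largest, and so on downwards. *)
Lemma perm_fix_top (s : 'S_(p + k)) :
  (forall d : 'I_k, (p + d <= s (rshift p d))%N) ->
  forall d : 'I_k, s (rshift p d) = rshift p d.
Proof.
move=> sd.
suff main m : forall d : 'I_k, (k - d <= m)%N -> s (rshift p d) = rshift p d.
  by move=> d; exact: (main k _ (leq_subr _ _)).
elim: m => [d|m IH d dm].
  by rewrite leqn0 subn_eq0 leqNgt ltn_ord.
have := sd d; case: (split_ordP (s (rshift p d))) => [l|d' e] => [->/=|].
  by move=> ?; have := ltn_ord l; lia.
rewrite e /= leq_add2l leq_eqVlt => /orP[/eqP dd'|dd'].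
  by congr (rshift p _); exact/esym/val_inj.
have sd' : s (rshift p d') = rshift p d' by apply: IH; lia.
by have := perm_inj (etrans e (esym sd')) => /rshift_inj dE; rewrite dE ltnn in dd'.
Qed.

(** By triangularity a nonzero term needs a permutation that lowers none of the last [k] indices,
    hence fixes them all. The p! permutations of the first [p] indices remain, and each contributes
    at most the product of the diagonal entries. *)
Lemma wedge_pullback_frame_bound a F (E : 'M[R]_(p + k)) :
  (forall s, `|a (usubmx (row_perm s E))| <= 1) ->
  (forall (r : 'I_(p + k)) (d : 'I_k), (r < p + d)%N -> (E *m F) r d = 0) ->
  `|wedge_pullback a F E| <=
    p`!%:R * \prod_(d < k) `|(E *m F) (rshift p d) d|.
Proof.
move=> a1 EF0; pose A := [set lshift k l | l : 'I_p]%SET.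
have cA : #|A| = p by rewrite card_imset ?card_ord//; exact: lshift_inj.
rewrite -{2}cA -card_perm mulr_natl -sumr_const.
apply: (le_trans (ler_norm_sum _ _ _)).
rewrite [leRHS]big_mkcond/=; apply: ler_sum => s _.
rewrite !normrM normrX normrN1 expr1n mul1r normr_prod.
case: ifPn => [|sA].
  rewrite unfold_in => /fintype.subsetP sA.
  rewrite (eq_bigr (fun d => `|(E *m F) (rshift p d) d|)); last first.
    move=> d _; congr (`|(E *m F) _ _|); apply/eqP; apply: contraT => sd.
    have := sA (rshift p d); rewrite inE sd => /(_ isT) /imsetP[l _ /eqP].
    by rewrite eq_rlshift.
  by rewrite ler_piMl// prodr_ge0.
suff -> : \prod_(d < k) `|(E *m F) (s (rshift p d)) d| = 0 by rewrite mulr0.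
apply/eqP; apply: contraNT sA => /prodf_neq0 P0.
have sfix : forall d, s (rshift p d) = rshift p d.
  apply: perm_fix_top => d; rewrite leqNgt; apply/negP => lt.
  by have := P0 d isT; rewrite EF0// normr0 eqxx.
rewrite unfold_in; apply/fintype.subsetP => i; rewrite inE.
case: (split_ordP i) => [l ->|d ->]; first by move=> _; apply: imset_f.
by rewrite sfix eqxx.
Qed.

(** With [g = C *m C^T] and a frame [E] adapted to [F *m C], the trace is the sum of the squares of
    all entries of [T], while the wedge is at most p! times the product of the diagonal entries of
    its triangular block; the inequality of the means compares the two. Both sides are squared so
    that they are polynomial in [F]. *)
Lemma calibration_bound a F (h : 'M[R]_(p + k)) (g : 'M[R]_k) : (0 < k)%N ->
  posdef_mx h -> posdef_mx g -> multilinear_form a ->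
  (forall W, W *m h *m W^T = 1%:M -> `|a W| <= 1) ->
  \det g * wedge_pullback a F 1%:M ^+ 2 <=
  p`!%:R ^+ 2 * \det h * (\tr (invmx h *m (F *m g *m F^T)) / k%:R) ^+ k.
Proof.
move=> k0 hP gP aM a1.
have [C _ gE] := posdef_factor gP.
have [E [Eh EF]] := adapted_frame (F *m C) hP.
have EhE : E^T *m E *m h = 1%:M.
  by rewrite -mulmxA; apply: mulmx1C.
have [_ hu] := mulmx1_unit EhE.
have hV : invmx h = E^T *m E.
  by rewrite -[LHS]mul1mx -EhE mulmxK.
have detE : \det E ^+ 2 * \det h = 1.
  by rewrite -(det1 R (p + k)) -EhE !det_mulmx det_tr expr2.
have dh0 : 0 <= \det h.
  have : \det E ^+ 2 != 0.
    by apply/negP => /eqP e; move/eqP: detE; rewrite e mul0r eq_sym oner_eq0.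
  move=> E0; have -> : \det h = (\det E ^+ 2)^-1.
    by apply: (mulfI E0); rewrite detE mulfV.
  by rewrite invr_ge0 sqr_ge0.
(* Passing to the frame [E] costs [\det E], whose square is the inverse of [\det h]; absorbing [C]
   costs [\det C], whose square is [\det g]. *)
have -> : \det g * wedge_pullback a F 1%:M ^+ 2 =
    \det h * wedge_pullback a (F *m C) E ^+ 2.
  rewrite (wedge_pullback_top _ E aM) wedge_pullback_mulr !exprMn [RHS]mulrA.
  by rewrite [\det h * _]mulrC detE mul1r {1}gE det_mulmx det_tr -expr2.
rewrite [_ * \det h]mulrC -mulrA ler_wpM2l//.
have := wedge_pullback_frame_bound (F := F *m C) (E := E) (a := a) _ EF.
move=> /(_ _)/wrap[s|bnd].
  (* Any [p] distinct rows of an orthonormal frame are orthonormal, so the calibration bound applies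
     to them. *)
  apply: a1; apply/matrixP => i j; move/matrixP : Eh.
  move/(_ (s (lshift k i)) (s (lshift k j))).
  rewrite [in X in _ = X -> _]mxE (inj_eq (@perm_inj _ s)) (inj_eq (@lshift_inj _ _)) => e.
  rewrite [in RHS]mxE -e !mxE; apply: eq_bigr => l _; rewrite !mxE.
  by congr (_ * _); apply: eq_bigr => l' _; rewrite !mxE.
rewrite -real_normK ?num_real//.
set T := E *m (F *m C) in bnd EF *.
apply: (@le_trans _ _ ((p`!%:R * \prod_(d < k) `|T (rshift p d) d|) ^+ 2)).
  by rewrite lerXn2r// nnegrE ?mulr_ge0 ?prodr_ge0.
rewrite exprMn ler_wpM2l ?sqr_ge0//.
rewrite -prodrXl.
have [+ _] := leif_AGM (A := predT) (E := fun d : 'I_k => `|T (rshift p d) d| ^+ 2)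
  (fun i _ => exprn_ge0 _ (normr_ge0 _)).
rewrite !(eq_bigl _ _ (fun=> erefl)) cardT size_enum_ord => /le_trans; apply.
have trE : \tr (invmx h *m (F *m g *m F^T)) = \sum_r \sum_d T r d ^+ 2.
  rewrite -mxtrace_mulmx_trmx hV gE /T !trmx_mul -!mulmxA mxtrace_mulC.
  by rewrite -!mulmxA.
rewrite trE lerXn2r// ?nnegrE ?divr_ge0 ?sumr_ge0//.
  by move=> r _; rewrite sumr_ge0// => d _; rewrite sqr_ge0.
(* From the sum of squares the first [p] rows are dropped, and then the off-diagonal entries of the
   last [k] rows. *)
rewrite ler_pM2r ?invr_gt0 ?ltr0n// big_split_ord/= ler_wpDl//.
  by rewrite sumr_ge0// => r _; rewrite sumr_ge0// => d _; rewrite sqr_ge0.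
apply: ler_sum => d _; rewrite real_normK ?num_real// (bigD1 d)//= lerDl.
by rewrite sumr_ge0// => d' _; rewrite sqr_ge0.
Qed.

End CalibrationBound.

(** If [h = B *m B^T] and [g = C *m C^T], the trace is the sum of the squares of the entries of
    [invmx B *m F *m C]. *)
Lemma energy_ge0_eq0 (R : realType) (m n : nat) (h : 'M[R]_m) (g : 'M[R]_n)
    (F : 'M[R]_(m, n)) : posdef_mx h -> posdef_mx g ->
  0 <= \tr (invmx h *m (F *m g *m F^T)) /\
  (\tr (invmx h *m (F *m g *m F^T)) = 0 -> F = 0).
Proof.
move=> /posdef_factor[B Bu hB] /posdef_factor[C Cu gC].
pose T := invmx B *m F *m C.
have -> : \tr (invmx h *m (F *m g *m F^T)) = \tr (T *m T^T).
  have BTu : B^T \in unitmx by rewrite unitmx_tr.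
  have -> : invmx h = (invmx B)^T *m invmx B.
    apply: (can_inj (mulmxK (_ : h \in unitmx))); first by rewrite hB unitmx_mul Bu.
    rewrite mulVmx; last by rewrite hB unitmx_mul Bu.
    by rewrite hB mulmxA -(mulmxA _ _ B) mulVmx// mulmx1 trmx_inv mulVmx.
  by rewrite gC /T !trmx_mul -!mulmxA mxtrace_mulC -!mulmxA.
rewrite mxtrace_mulmx_trmx; split.
  by rewrite sumr_ge0// => i _; rewrite sumr_ge0// => j _; exact: sqr_ge0.
move=> /eqP; rewrite psumr_eq0; last first.
  by move=> i _; rewrite sumr_ge0// => j _; exact: sqr_ge0.
move=> /allP T0; have {}T0 : T = 0.
  apply/matrixP => i j; have := T0 i (mem_index_enum _) => /=.
  rewrite psumr_eq0; last by move=> ? _; exact: sqr_ge0.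
  by move=> /allP/(_ j (mem_index_enum _))/=; rewrite sqrf_eq0 [RHS]mxE => /eqP.
have : B *m T *m invmx C = F by rewrite /T !mulmxA mulmxV// mul1mx mulmxK.
by rewrite T0 mulmx0 mul0mx.
Qed.

(** * The first cousin identity *)

Lemma nonneg_poly_deriv0 (R : realType) (q : {poly R}) :
  (forall t, 0 <= q.[t]) -> q.[0] = 0 -> q^`().[0] = 0.
Proof.
move=> q0 q00.
have : is_derive (0 : R) 1 (horner q) 0.
  apply: (@derive1_at_min _ _ (-1) 1); rewrite ?lerN10//.
  - by rewrite in_itv/= ltrN10 ltr01.
  - by move=> t _; rewrite q00.
move=> /@derive_val; by rewrite -derive1E -derivE.
Qed.

(** [Phi] stands for the wedge and [Psi] for its derivative in one entry of [F], [N] for the norm of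
    [F], [G] and [H] for the square roots of the determinants of the metrics, and [P] for p!. The
    difference of the two sides of the bound is a nonnegative polynomial in [t] that vanishes at 0,
    so its derivative there is 0; cancelling [G * Phi] gives the claim. *)
Lemma first_cousin_scalar (R : realType) (k : nat) (P G H N b e Phi Psi : R)
    (r := Num.sqrt k%:R) : (1 < k)%N ->
  0 < P -> 0 < G -> 0 < H -> 0 < N ->
  G * Phi = P * (r ^+ k)^-1 * N ^+ k * H ->
  (forall t, G ^+ 2 * (Phi + t * Psi) ^+ 2 <=
     P ^+ 2 * H ^+ 2 * ((N ^+ 2 + t * (2 * b) + t ^+ 2 * e) / k%:R) ^+ k) ->
  G * Psi = P * (r ^+ k)^-1 * k%:R * N ^+ (k - 2) * H * b.
Proof.
move=> k1 P0 G0 H0 N0 GPhi bound.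
have k0 : 0 < k%:R :> R by rewrite ltr0n ltnW.
have r0 : 0 < r by rewrite sqrtr_gt0.
have rk : k%:R = r ^+ 2 by rewrite sqr_sqrtr ?ltW.
pose q : {poly R} := (P ^+ 2 * H ^+ 2) *:
  ((N ^+ 2 / k%:R)%:P + (2 * b / k%:R) *: 'X + (e / k%:R) *: 'X^2) ^+ k
  - (G ^+ 2) *: (Phi%:P + Psi *: 'X) ^+ 2.
have qE t : q.[t] = P ^+ 2 * H ^+ 2 *
    ((N ^+ 2 + t * (2 * b) + t ^+ 2 * e) / k%:R) ^+ k - G ^+ 2 * (Phi + t * Psi) ^+ 2.
  rewrite /q hornerD hornerN !hornerZ !horner_exp !hornerD !hornerZ.
  rewrite hornerXn hornerX !hornerC.
  by congr (_ * _ ^+ _ - _ * _ ^+ _); rewrite ?mulrDl; ring.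
have q00 : q.[0] = 0.
  have GG : G ^+ 2 * Phi ^+ 2 = (P * (r ^+ k)^-1 * N ^+ k * H) ^+ 2.
    by rewrite -exprMn GPhi.
  rewrite qE !mul0r expr0n/= mul0r !addr0 GG rk expr_div_n -!exprM.
  rewrite mulnC !exprM !exprMn exprVn.
  move: (r ^+ k) (N ^+ k) => x y; ring.
have /nonneg_poly_deriv0/(_ q00) : forall t, 0 <= q.[t].
  by move=> t; rewrite qE subr_ge0.
rewrite /q derivB !derivZ !deriv_exp !derivD !derivZ derivXn derivX !derivC.
rewrite hornerD hornerN !hornerZ !hornerMn !hornerM !horner_exp !hornerD !hornerZ.
rewrite hornerMn !hornerE expr0n/= !(mulr0, mul0r, mul0rn, addr0, add0r, mulr1).
(* Writing k = l + 2 turns the truncated difference [k - 2] into [l]. *)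
case: k k1 @r k0 r0 rk GPhi {bound q qE q00} => [//|[//|l]] _ r k0 r0 rk GPhi.
rewrite subn2/= -mulr_natr rk => /eqP; rewrite subr_eq0 expr1 => /eqP eq2.
have N_neq0 := lt0r_neq0 N0; have r_neq0 := lt0r_neq0 r0.
have G_neq0 := lt0r_neq0 G0.
have GPhi0 : G * Phi != 0.
  rewrite GPhi lt0r_neq0//; apply: mulr_gt0 => //; apply: mulr_gt0; last exact: exprn_gt0.
  by apply: mulr_gt0 => //; rewrite invr_gt0 exprn_gt0.
apply: (mulfI GPhi0).
have -> : (G * Phi) * (G * Psi) = (G ^+ 2 * (Psi * Phi *+ 2)) / 2.
  by rewrite mulr2n; field.
rewrite -eq2 GPhi.
have -> : (N ^+ 2 / r ^+ 2) ^+ l.+1 = (N ^+ l) ^+ 2 * N ^+ 2 / ((r ^+ l) ^+ 2 * r ^+ 2).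
  by rewrite exprSr expr_div_n -!exprM mulnC; field; rewrite r_neq0 expf_neq0.
rewrite !exprS; have := expf_neq0 l r_neq0.
move: (N ^+ l) (r ^+ l) => x y y0; field; rewrite ?r_neq0 ?y0.
by [].
Qed.

Lemma signed_sum_tperm_eq0 (R : realType) (n : nat) (i j : 'I_n) (f : 'S_n -> R) :
  i != j -> (forall s, f (tperm i j * s)%g = f s) ->
  \sum_(s : 'S_n) (-1) ^+ s * f s = 0.
Proof.
move=> ij fs; set S := \sum_(_ : _) _.
suff /eqP : S = - S by rewrite -addr_eq0 -mulr2n mulrn_eq0/= => /eqP.
rewrite {1}/S (reindex_inj (mulgI (tperm i j))) /= -sumrN; apply: eq_bigr => s _.
by rewrite fs odd_permM odd_tperm ij signr_addb expr1 mulN1r mulNr.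
Qed.

Section FirstCousin.
Variables (R : realType) (p k : nat).
Implicit Types (a : 'M[R]_(p, p + k) -> R) (F : 'M[R]_(p + k, k)).

(* The entry [(i, c)] is the partial derivative of [wedge_pullback a F 1] with
   respect to [F i c]. *)
Definition wedge_cofactor a F : 'M[R]_(p + k, k) := \matrix_(i, c)
  \sum_(s : 'S_(p + k)) (-1) ^+ s * (a (usubmx (perm_mx s)) *
    (s (rshift p c) == i)%:R * \prod_(d < k | d != c) F (s (rshift p d)) d).

Lemma wedge_pullback1 a F : wedge_pullback a F 1%:M =
  \sum_(s : 'S_(p + k)) (-1) ^+ s * (a (usubmx (perm_mx s)) *
    \prod_(d < k) F (s (rshift p d)) d).
Proof.
apply: eq_bigr => s _; rewrite -mulrA row_permE mulmx1; congr (_ * (_ * _)).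
by apply: eq_bigr => d _; rewrite mul1mx.
Qed.

(** Each product contains exactly one factor from column [c] of [F], so the dependence on [t] is
    affine and the bound along this line is polynomial. *)
Lemma wedge_pullback_affine a F i c t :
  wedge_pullback a (F + t *: delta_mx i c) 1%:M =
  wedge_pullback a F 1%:M + t * wedge_cofactor a F i c.
Proof.
rewrite !wedge_pullback1 mxE mulr_sumr -big_split/=; apply: eq_bigr => s _.
rewrite [t * _]mulrCA -mulrDr; congr (_ * _).
rewrite (bigD1 c)//= [in RHS](bigD1 c)//=.
rewrite (eq_bigr (fun d => F (s (rshift p d)) d)); last first.
  by move=> d dc; rewrite !mxE (negPf dc) andbF mulr0 addr0.
rewrite !mxE eqxx andbT; set P := \prod_(_ < _ | _) _.
move: P (a _) (F _ _) (_ == _)%:R => P A f b; ring.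
Qed.

(** This is the analogue of the Laplace expansion. On the diagonal, column [c] is restored; off the
    diagonal, column [e] occurs twice and the transposition of the slots [c] and [e] cancels the
    sum. Conformality of the differential will follow from it. *)
Lemma trmx_mul_wedge_cofactor a F :
  F^T *m wedge_cofactor a F = (wedge_pullback a F 1%:M)%:M.
Proof.
apply/matrixP => e c; rewrite wedge_pullback1 !mxE.
transitivity (\sum_(s : 'S_(p + k)) (-1) ^+ s * (a (usubmx (perm_mx s)) *
    (F (s (rshift p c)) e * \prod_(d < k | d != c) F (s (rshift p d)) d))).
  under eq_bigr do rewrite !mxE mulr_sumr.
  rewrite exchange_big/=; apply: eq_bigr => s _.
  set P := \prod_(_ < k | _) _; clearbody P.
  rewrite (bigD1 (s (rshift p c)))//= big1 ?addr0 => [|i /negPf]; last first.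
    by rewrite eq_sym => ->; rewrite mulr0 mul0r !mulr0.
  by rewrite eqxx mulr1 mulrCA; congr (_ * _); rewrite mulrCA.
have [->|ec] := eqVneq e c.
  by rewrite mulr1n; apply: eq_bigr => s _; rewrite [in RHS](bigD1 c).
rewrite mulr0n; apply: (@signed_sum_tperm_eq0 _ _ (rshift p c) (rshift p e)).
  by rewrite (inj_eq (@rshift_inj _ _)) eq_sym.
move=> s; congr (_ * _).
  congr a; apply/matrixP => l j; rewrite !mxE permM tpermD// eq_rlshift//.
rewrite permM tpermL [in LHS](bigD1 e)//= [in RHS](bigD1 e)//=.
rewrite permM tpermR mulrCA; congr (_ * (_ * _)).
apply: eq_bigr => d /andP[dc de].
by rewrite permM tpermD// (inj_eq (@rshift_inj _ _)) eq_sym.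
Qed.

(** As k is at least 2, every product keeps a factor from [F]. This handles the points where the
    differential vanishes. *)
Lemma wedge_cofactor0 a : (1 < k)%N -> wedge_cofactor a 0 = 0.
Proof.
move=> k1; apply/matrixP => i c; rewrite !mxE big1// => s _.
have [d dc] : exists d : 'I_k, d != c.
  have k0 := ltnW k1.
  have [c0|c0] := eqVneq c (Ordinal k0); last by exists (Ordinal k0); rewrite eq_sym.
  by exists (Ordinal k1); rewrite c0.
by rewrite (bigD1 d)//= mxE mul0r !mulr0.
Qed.

Lemma energy_affine F (h : 'M[R]_(p + k)) (g : 'M[R]_k) i c :
  posdef_mx h -> posdef_mx g -> exists e, forall t,
  let Ft := F + t *: delta_mx i c in
  \tr (invmx h *m (Ft *m g *m Ft^T)) =
  \tr (invmx h *m (F *m g *m F^T)) + t * (2 * (invmx h *m F *m g) i c) + t ^+ 2 * e.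
Proof.
move=> hP gP; set D := delta_mx i c.
exists (\tr (invmx h *m (D *m g *m D^T))) => t /=.
have trD (X : 'M[R]_(p + k, k)) : \tr (X *m D^T) = X i c.
  rewrite /mxtrace (bigD1 i)//= big1 ?addr0 => [|j ji].
    rewrite mxE (bigD1 c)//= big1 ?addr0 => [|d dc]; first by rewrite !mxE !eqxx mulr1.
    by rewrite !mxE (negPf dc) andbF mulr0.
  by rewrite mxE big1// => d _; rewrite !mxE (negPf ji) mulr0.
have sym : \tr (invmx h *m (D *m g *m F^T)) = \tr (invmx h *m (F *m g *m D^T)).
  rewrite -mxtrace_tr !trmx_mul trmxK trmx_inv hP.1 gP.1.
  by rewrite mxtrace_mulC !mulmxA.
have cross : \tr (invmx h *m (F *m g *m D^T)) = (invmx h *m F *m g) i c.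
  by rewrite !mulmxA trD.
rewrite linearD linearZ/= !(mulmxDl, mulmxDr, linearD)/=.
rewrite -!scalemxAl -!scalemxAr !mxtraceZ sym cross.
move: (\tr (_ *m (F *m _ *m _))) (\tr (_ *m (D *m _ *m _))) ((_ *m g) i c) => x y z.
by ring.
Qed.

(* The calibration inequality is an equality at [F], hence its derivative
   along each elementary matrix vanishes there. *)
Lemma first_cousin a F (h : 'M[R]_(p + k)) (g : 'M[R]_k)
    (N := Num.sqrt (\tr (invmx h *m (F *m g *m F^T)))) :
  (1 < k)%N -> posdef_mx h -> posdef_mx g -> multilinear_form a ->
  (forall W, W *m h *m W^T = 1%:M -> `|a W| <= 1) ->
  Num.sqrt (\det g) * wedge_pullback a F 1%:M =
    p`!%:R * (Num.sqrt k%:R ^+ k)^-1 * N ^+ k * Num.sqrt (\det h) ->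
  Num.sqrt (\det g) *: wedge_cofactor a F =
    (p`!%:R * (Num.sqrt k%:R ^+ k)^-1 * k%:R * N ^+ (k - 2) * Num.sqrt (\det h)) *:
      (invmx h *m F *m g).
Proof.
move=> k1 hP gP aM a1 smith.
have [m_ge0 m_eq0] := energy_ge0_eq0 F hP gP.
(* Zero energy means [F = 0], and then both sides vanish. Otherwise [N] is positive, as the scalar
   argument requires. *)
have [m0|m_neq0] := eqVneq (\tr (invmx h *m (F *m g *m F^T))) 0.
  by rewrite (m_eq0 m0) wedge_cofactor0// mulmx0 mul0mx !scaler0.
have N0 : 0 < N by rewrite sqrtr_gt0 lt0r m_neq0.
have Nm : N ^+ 2 = \tr (invmx h *m (F *m g *m F^T)) by rewrite sqr_sqrtr.
have dg0 := posdef_det_gt0 gP; have dh0 := posdef_det_gt0 hP.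
apply/matrixP => i c; rewrite [LHS]mxE [RHS]mxE.
have [e eE] := energy_affine F i c hP gP.
apply: (first_cousin_scalar (Phi := wedge_pullback a F 1%:M) (e := e)) => //.
- by rewrite sqrtr_gt0.
- by rewrite sqrtr_gt0.
move=> t; rewrite -wedge_pullback_affine Nm -eE.
rewrite (sqr_sqrtr (ltW dg0)) (sqr_sqrtr (ltW dh0)).
by apply: calibration_bound => //; exact: ltnW.
Qed.

End FirstCousin.

(** * Contraction of Christoffel symbols and derivatives over a frame *)

Section ChristoffelContraction.
Variable (R : realType).

(** Such a sum sees [P] and [Q] only through [P^T *m Q]. For an orthonormal frame this product is
    the inverse metric, and the frame disappears. *)
Lemma sum_row_mulmx_linear (m n r q : nat) (P : 'M[R]_(m, n)) (Q : 'M[R]_(m, r))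
    (X : 'I_n -> 'M[R]_(r, q)) :
  \sum_l row l Q *m (\sum_b P l b *: X b) = \sum_b row b (P^T *m Q) *m X b.
Proof.
under eq_bigr do rewrite mulmx_sumr.
rewrite exchange_big/=; apply: eq_bigr => b _.
rewrite row_mul (mulmx_sum_row (row b P^T)) mulmx_suml; apply: eq_bigr => l _.
by rewrite -scalemxAr -scalemxAl !mxE.
Qed.

Lemma sum_row_scale_linear (m n r : nat) (P : 'M[R]_(m, n)) (Q : 'M[R]_(m, r))
    (x : 'I_n -> R) :
  \sum_l (\sum_b P l b * x b) *: row l Q = \sum_b x b *: row b (P^T *m Q).
Proof.
rewrite -(eq_bigr _ (fun b _ => mul_mx_scalar (x b) _)).
rewrite -sum_row_mulmx_linear; apply: eq_bigr => l _.
rewrite -mul_mx_scalar; congr (_ *m _); rewrite raddf_sum/=.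
by apply: eq_bigr => b _; rewrite scale_scalar_mx.
Qed.

(** The trace of the Christoffel symbols with respect to the inverse metric; the first two terms of
    the Christoffel formula coincide after contraction. *)
Definition contracted_christoffel (n : nat) (H : 'M[R]_n) (dH : 'I_n -> 'M[R]_n) :
    'rV[R]_n :=
  (\sum_c row c (invmx H) *m dH c - 2^-1 *: \row_c \tr (invmx H *m dH c)) *m invmx H.

(** The lemma serves on both manifolds: on the source with [P = Q = E] and [mu = 1], and on the
    target with the images of [E] under [J] and [A], where the hypothesis on [P^T *m Q] is
    conformality. *)
Lemma sum_christoffel_formula (m n : nat) (H : 'M[R]_n) (dH : 'I_n -> 'M[R]_n)
    (DH : 'rV[R]_n -> 'M[R]_n) (P Q : 'M[R]_(m, n)) (mu : R) :
  H^T = H -> (forall c, DH (delta_mx 0 c) = dH c) ->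
  (forall v, DH v = \sum_b v 0 b *: dH b) -> P^T *m Q = mu *: invmx H ->
  \sum_l (2^-1 *: (row l Q *m DH (row l P) + row l P *m DH (row l Q)
      - \row_c (row l P *m DH (delta_mx 0 c) *m (row l Q)^T) 0 0)) *m invmx H =
  mu *: contracted_christoffel H dH.
Proof.
move=> HT DHe DHl PQ.
have QP : Q^T *m P = mu *: invmx H.
  by rewrite -[LHS]trmxK trmx_mul trmxK PQ linearZ/= trmx_inv HT.
have DHr (X : 'M[R]_(m, n)) l : DH (row l X) = \sum_b X l b *: dH b.
  by rewrite DHl; apply: eq_bigr => b _; rewrite mxE.
have rowZ b : row b (mu *: invmx H) = mu *: row b (invmx H).
  by apply/rowP => j; rewrite !mxE.
have s1 : \sum_l row l Q *m DH (row l P) = mu *: \sum_c row c (invmx H) *m dH c.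
  under eq_bigr do rewrite DHr.
  rewrite sum_row_mulmx_linear PQ scaler_sumr; apply: eq_bigr => c _.
  by rewrite rowZ -scalemxAl.
have s2 : \sum_l row l P *m DH (row l Q) = mu *: \sum_c row c (invmx H) *m dH c.
  under eq_bigr do rewrite DHr.
  rewrite sum_row_mulmx_linear QP scaler_sumr; apply: eq_bigr => c _.
  by rewrite rowZ -scalemxAl.
have s3 : \sum_l \row_c (row l P *m DH (delta_mx 0 c) *m (row l Q)^T) 0 0 =
    mu *: \row_c \tr (invmx H *m dH c).
  apply/rowP => c; rewrite summxE !mxE.
  transitivity (\tr (P *m dH c *m Q^T)).
    apply: eq_bigr => l _; rewrite [LHS]mxE DHe -row_mul !mxE.
    by apply: eq_bigr => j _; rewrite !mxE.
  by rewrite mxtrace_mulC mulmxA QP -scalemxAl mxtraceZ.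
rewrite -mulmx_suml -scaler_sumr sumrB big_split/= s1 s2 s3 /contracted_christoffel.
rewrite scalemxAl; congr (_ *m _).
move: (\sum_c _) (\row_c _) => S T; apply/rowP => j; by rewrite !mxE; field.
Qed.

(* Here [x] is the logarithmic derivative of [rho], which is
   [sqrt (det G / det h)] up to a constant. *)
Lemma sum_frame_derivative (n k : nat) (h : 'M[R]_n) (G : 'M[R]_k)
    (E : 'M[R]_n) (A J Psi : 'M[R]_(n, k)) (rho mu : R)
    (h' : 'I_n -> 'M[R]_n) (G' : 'I_k -> 'M[R]_k) (Psi' : 'I_n -> 'M[R]_(n, k))
    (A' : 'rV[R]_n -> 'M[R]_(n, k)) :
  h \in unitmx -> G \in unitmx -> E^T *m E = invmx h ->
  A *m G = rho *: (h *m Psi) -> J^T *m invmx h *m A = mu *: invmx G ->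
  \sum_b row b (Psi' b) = 0 ->
  (forall v : 'rV[R]_n,
    let x := 2^-1 * (\sum_d (v *m J) 0 d * \tr (invmx G *m G' d))
             - 2^-1 * (\sum_b v 0 b * \tr (invmx h *m h' b)) in
    A' v *m G + A *m (\sum_d (v *m J) 0 d *: G' d) =
    (rho * x) *: (h *m Psi) + rho *: ((\sum_b v 0 b *: h' b) *m Psi
      + h *m (\sum_b v 0 b *: Psi' b))) ->
  \sum_l row l E *m A' (row l E) =
    contracted_christoffel h h' *m A - mu *: contracted_christoffel G G'.
Proof.
move=> hu Gu EE AG conf divPsi A'E.
have rowEb l b : row l E 0 b = E l b by rewrite mxE.
have rowEJ l d : (row l E *m J) 0 d = (E *m J) l d by rewrite -row_mul mxE.
have EJA : (E *m J)^T *m (E *m A) = mu *: invmx G.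
  by rewrite trmx_mul -mulmxA (mulmxA E^T) EE mulmxA.
have EJAG : (E *m J)^T *m (E *m A *m G) = mu%:M.
  by rewrite mulmxA EJA -scalemxAl mulVmx// scalemx1.
have EAG : E^T *m (E *m A *m G) = invmx h *m A *m G by rewrite !mulmxA EE.
have rowZ d : row d (mu *: invmx G) = mu *: row d (invmx G).
  by apply/rowP => j; rewrite !mxE.
apply: (can_inj (mulmxK Gu)); rewrite mulmx_suml.
(* The differentiated identity along row [l] of [E] is solved for [A'], and [rho *: Psi] is replaced
   by [invmx h *m A *m G]. *)
have term l : row l E *m A' (row l E) *m G =
    - (row l (E *m A) *m (\sum_d (E *m J) l d *: G' d))
    + 2^-1 *: ((\sum_d (E *m J) l d * \tr (invmx G *m G' d)) *: row l (E *m A *m G))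
    - 2^-1 *: ((\sum_b E l b * \tr (invmx h *m h' b)) *: row l (E *m A *m G))
    + row l E *m (\sum_b E l b *: h' b) *m (invmx h *m A *m G)
    + rho *: (row l (E *m h) *m (\sum_b E l b *: Psi' b)).
  have := A'E (row l E).
  have -> : \sum_d (row l E *m J) 0 d *: G' d = \sum_d (E *m J) l d *: G' d.
    by apply: eq_bigr => d _; rewrite rowEJ.
  have -> : \sum_d (row l E *m J) 0 d * \tr (invmx G *m G' d) =
      \sum_d (E *m J) l d * \tr (invmx G *m G' d).
    by apply: eq_bigr => d _; rewrite rowEJ.
  have -> : \sum_b row l E 0 b * \tr (invmx h *m h' b) =
      \sum_b E l b * \tr (invmx h *m h' b).
    by apply: eq_bigr => d _; rewrite rowEb.
  have -> : \sum_b row l E 0 b *: h' b = \sum_b E l b *: h' b.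
    by apply: eq_bigr => d _; rewrite rowEb.
  have -> : \sum_b row l E 0 b *: Psi' b = \sum_b E l b *: Psi' b.
    by apply: eq_bigr => d _; rewrite rowEb.
  move: (\sum_d (E *m J) l d *: G' d) (\sum_d (E *m J) l d * \tr (invmx G *m G' d))
    (\sum_b E l b * \tr (invmx h *m h' b)) (\sum_b E l b *: h' b)
    (\sum_b E l b *: Psi' b) => S1 c1 c2 Hs Ps /= e.
  rewrite -mulmxA.
  have -> : A' (row l E) *m G = - (A *m S1) + (2^-1 * c1) *: (A *m G)
      - (2^-1 * c2) *: (A *m G) + Hs *m (invmx h *m A *m G) + rho *: (h *m Ps).
    rewrite -(mulmxA (invmx h)) AG -scalemxAr mulmxA mulVmx// mul1mx.
    apply: (addIr (A *m S1)); rewrite e -scalemxAr mulrBr scalerBl.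
    rewrite !scalerA ![_ * rho]mulrC scalerDr.
    move: (A *m S1) (_ *: (h *m Psi)) (_ *: (h *m Psi)) (rho *: _) (rho *: _) => a b c d f.
    by apply/matrixP => i j; rewrite !mxE; ring.
  rewrite !row_mul !(mulmxDr, mulmxN) -!scalemxAr !mulmxA !scalerA.
  by [].
(* In [t1] and [t2], which carry the derivatives of [G], conformality turns the frame sums into [mu]
   times contractions with [invmx G]; [t3] and [t4] contract the derivatives of [h] with
   [invmx h]. *)
have t1 : \sum_l row l (E *m A) *m (\sum_d (E *m J) l d *: G' d) =
    mu *: \sum_d row d (invmx G) *m G' d.
  rewrite sum_row_mulmx_linear EJA scaler_sumr.
  by apply: eq_bigr => d _; rewrite rowZ -scalemxAl.
have t2 : \sum_l (\sum_d (E *m J) l d * \tr (invmx G *m G' d)) *: row l (E *m A *m G) =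
    mu *: \row_d \tr (invmx G *m G' d).
  rewrite sum_row_scale_linear EJAG; apply/rowP => j.
  rewrite summxE (bigD1 j)//= big1 ?addr0 => [|d /negPf dj].
    by rewrite !mxE eqxx mulr1n mulrC.
  by rewrite !mxE dj mulr0n mulr0.
have t3 : \sum_l (\sum_b E l b * \tr (invmx h *m h' b)) *: row l (E *m A *m G) =
    (\row_b \tr (invmx h *m h' b)) *m (invmx h *m A *m G).
  rewrite sum_row_scale_linear EAG mulmx_sum_row.
  by apply: eq_bigr => b _; rewrite mxE.
have t4 : \sum_l row l E *m (\sum_b E l b *: h' b) =
    \sum_b row b (invmx h) *m h' b.
  by rewrite sum_row_mulmx_linear EE.
(* Contraction cancels [h] against its inverse and leaves the divergence of [Psi]. *)
have t5 : \sum_l row l (E *m h) *m (\sum_b E l b *: Psi' b) = 0.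
  rewrite sum_row_mulmx_linear mulmxA EE mulVmx// -[RHS]divPsi.
  by apply: eq_bigr => b _; rewrite row1 -rowE.
rewrite (eq_bigr _ (fun l _ => term l)) !big_split/= !sumrN -!scaler_sumr t1 t2 t3 t5.
rewrite -mulmx_suml t4 scaler0 addr0 mulmxBl -scalemxAl /contracted_christoffel.
rewrite -(mulmxA _ (invmx G)) mulVmx// mulmx1 -!(mulmxA _ (invmx h)).
rewrite -(mulmxA _ (invmx h *m A)) mulmxBl -scalemxAl.
move: (\sum_d row d (invmx G) *m G' d) (\row_d \tr (invmx G *m G' d)) => S T.
move: ((\sum_b row b (invmx h) *m h' b) *m (invmx h *m A *m G))
  ((\row_b \tr (invmx h *m h' b)) *m (invmx h *m A *m G)) => X Y.
by apply/rowP => j; rewrite !mxE; ring.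
Qed.

End ChristoffelContraction.

(** * Directional derivatives of matrix-valued maps *)

Section DirectionalDerivatives.
Variables (R : realType) (V : normedModType R) (y v : V).

(** Restriction to a line makes the chain rule and the mean value theorem in one variable
    available. *)
Lemma is_derive_line (W : normedModType R) (f : V -> W) (z w : V) (t : R) (df : W) :
  is_derive (t *: w + z) w f df <-> is_derive t 1 (fun s => f (s *: w + z)) df.
Proof.
have E : (fun h : R => h^-1 *: ((f \o shift (t *: w + z)) (h *: w) - f (t *: w + z))) =
    (fun h : R => h^-1 *: (((fun s => f (s *: w + z)) \o shift t) (h *: 1) -
       f (t *: w + z))).
  apply/funext => h /=; congr (_ *: (f _ - _)).
  by rewrite [h *: 1]mulr1 scalerDl addrA.
split=> -[d1 d2].
- by split; [rewrite /derivable -E|rewrite -d2 /derive -E].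
- by split; [rewrite /derivable E|rewrite -d2 /derive E].
Qed.

Lemma is_derive_mxP (m n : nat) (X : V -> 'M[R]_(m, n)) (X' : 'M[R]_(m, n)) :
  is_derive y v X X' <-> forall i j, is_derive y v (fun z => X z i j) (X' i j).
Proof.
split=> [[dX <-] i j|dX].
  split; first by move/derivable_mxP : dX.
  by rewrite derive_mx// mxE.
have dX' : derivable X y v by apply/derivable_mxP => i j; case: (dX i j).
split=> //; rewrite derive_mx//; apply/matrixP => i j; rewrite mxE.
by case: (dX i j).
Qed.

Lemma is_derive_sum_seq (I : Type) (r : seq I) (P : pred I) (f : I -> V -> R)
    (f' : I -> R) : (forall i, is_derive y v (f i) (f' i)) ->
  is_derive y v (fun z => \sum_(i <- r | P i) f i z) (\sum_(i <- r | P i) f' i).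
Proof.
move=> df; elim: r => [|i r IH].
  under eq_fun do rewrite big_nil.
  by rewrite big_nil; exact: is_derive_cst.
rewrite big_cons; under eq_fun do rewrite big_cons.
by case: ifP => // _; apply: is_deriveD.
Qed.

Lemma is_derive_mul (f g : V -> R) (f' g' : R) :
  is_derive y v f f' -> is_derive y v g g' ->
  is_derive y v (fun z => f z * g z) (f' * g y + f y * g').
Proof.
move=> df dg; apply: (is_derive_eq (is_deriveM df dg)).
by rewrite addrC /GRing.scale/= [f' * _]mulrC.
Qed.

Lemma is_derive_prod_seq (I : eqType) (r : seq I) (f : I -> V -> R)
    (f' : I -> R) : uniq r -> (forall i, is_derive y v (f i) (f' i)) ->
  is_derive y v (fun z => \prod_(i <- r) f i z)
    (\sum_(e <- r) f' e * \prod_(i <- r | i != e) f i y).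
Proof.
move=> + df; elim: r => [_|a r IH /= /andP[ar ur]].
  under eq_fun do rewrite big_nil.
  by rewrite big_nil; exact: is_derive_cst.
rewrite big_cons; under eq_fun do rewrite big_cons.
apply: (is_derive_eq (is_derive_mul (df a) (IH ur))).
congr (_ * _ + _).
  rewrite big_cons eqxx/= big_seq [in RHS]big_seq_cond; apply: eq_bigl => i.
  by case: (boolP (i \in r)) => //= ir; rewrite (memPn ar).
rewrite mulr_sumr [in LHS]big_seq [in RHS]big_seq; apply: eq_bigr => e er.
by rewrite big_cons eq_sym (memPn ar)//= mulrCA.
Qed.

Lemma is_derive_prod (I : finType) (P : pred I) (f : I -> V -> R)
    (f' : I -> R) : (forall i, is_derive y v (f i) (f' i)) ->
  is_derive y v (fun z => \prod_(i | P i) f i z)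
    (\sum_(e | P e) f' e * \prod_(i | P i && (i != e)) f i y).
Proof.
move=> df; under eq_fun do rewrite -big_filter.
rewrite -big_filter; under eq_bigr do rewrite -big_filter_cond.
by apply: is_derive_prod_seq => //; rewrite filter_uniq// index_enum_uniq.
Qed.

Lemma is_derive_mulmx (m n q : nat) (X : V -> 'M[R]_(m, n)) (Y : V -> 'M[R]_(n, q))
    X' Y' : is_derive y v X X' -> is_derive y v Y Y' ->
  is_derive y v (fun z => X z *m Y z) (X' *m Y y + X y *m Y').
Proof.
move=> /is_derive_mxP dX /is_derive_mxP dY; apply/is_derive_mxP => i j.
under eq_fun do rewrite mxE.
rewrite !mxE -big_split/=; apply: is_derive_sum_seq => l.
exact: is_derive_mul.
Qed.

Lemma is_derive_scalemx (m n : nat) (c : V -> R) (X : V -> 'M[R]_(m, n)) c' X' :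
  is_derive y v c c' -> is_derive y v X X' ->
  is_derive y v (fun z => c z *: X z) (c' *: X y + c y *: X').
Proof.
move=> dc /is_derive_mxP dX; apply/is_derive_mxP => i j.
under eq_fun do rewrite mxE.
by rewrite !mxE; exact: is_derive_mul.
Qed.

(** Jacobi's formula. The terms that differentiate row [e] add up to the determinant with that row
    replaced by the one of [X'], which is then expanded along it. *)
Lemma is_derive_det (n : nat) (X : V -> 'M[R]_n) X' : is_derive y v X X' ->
  is_derive y v (fun z => \det (X z)) (\tr (\adj (X y) *m X')).
Proof.
move=> /is_derive_mxP dX.
have : is_derive y v (fun z => \det (X z)) (\sum_(s : 'S_n) (-1) ^+ s *
    \sum_e X' e (s e) * \prod_(i | i != e) X y i (s i)).
  apply: is_derive_sum_seq => s.
  have dP := is_derive_prod xpredT (fun i => dX i (s i)).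
  apply: (is_derive_eq (is_derive_mul (is_derive_cst ((-1) ^+ s : R) y v) dP)).
  by rewrite mul0r add0r.
move=> d; apply: (is_derive_eq d).
under eq_bigr do rewrite mulr_sumr.
rewrite exchange_big/= mxtrace_mulC; apply: eq_bigr => e _.
pose Z := set_row e (row e X') (X y).
transitivity (\det Z).
  apply: eq_bigr => s _; congr (_ * _).
  rewrite [RHS](bigD1 e)//= !mxE eqxx; congr (_ * _).
  by apply: eq_bigr => i /negPf ie; rewrite !mxE ie.
rewrite (expand_det_row _ e) mxE; apply: eq_bigr => j _.
rewrite !mxE eqxx; congr (_ * _); rewrite /cofactor; congr (_ * \det _).
by apply/matrixP => i l; rewrite !mxE eq_sym (negPf (neq_lift _ _)).
Qed.

Lemma is_derive_comp_line (f : V -> R) (g : R -> R) (f' g' : R) :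
  is_derive y v f f' -> is_derive (f y) 1 g g' ->
  is_derive y v (fun z => g (f z)) (g' * f').
Proof.
have y0 : y = 0 *: v + y by rewrite scale0r add0r.
move=> df dg; rewrite {1}y0; apply/is_derive_line.
rewrite y0 in df; move/is_derive_line : df => df.
apply: (@is_derive1_comp _ g) => //.
by rewrite -y0.
Qed.

Lemma is_derive_sqrt_det (n : nat) (X : V -> 'M[R]_n) X' :
  is_derive y v X X' -> 0 < \det (X y) ->
  is_derive y v (fun z => Num.sqrt (\det (X z)))
    (Num.sqrt (\det (X y)) * (2^-1 * \tr (invmx (X y) *m X'))).
Proof.
move=> dX X0; have s0 : 0 < Num.sqrt (\det (X y)) by rewrite sqrtr_gt0.
apply: (is_derive_eq (is_derive_comp_line (is_derive_det dX) (is_derive1_sqrt X0))).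
have Xu : X y \in unitmx by rewrite unitmxE unitfE lt0r_neq0.
have -> : \adj (X y) = \det (X y) *: invmx (X y).
  by rewrite /invmx Xu scalerA mulfV ?scale1r// lt0r_neq0.
rewrite -scalemxAl mxtraceZ -[\det (X y)](sqr_sqrtr (ltW X0)) sqrtr_sqr.
rewrite (gtr0_norm s0); move: (Num.sqrt _) (\tr _) s0 => s t s0.
by field; rewrite lt0r_neq0.
Qed.

(** Cramer's formula expresses the inverse by determinants. At singular matrices [invmx] has a
    default value, hence the assumption on a neighborhood. *)
Lemma derivable_invmx (n : nat) (X : V -> 'M[R]_n) : derivable X y v ->
  (\forall z \near y, X z \in unitmx) -> derivable (fun z => invmx (X z)) y v.
Proof.
move=> dX Xu.
apply: (@near_eq_derivable _ _ _ (fun z => (\det (X z))^-1 *: \adj (X z))).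
  by near=> z; rewrite /invmx (_ : X z \in unitmx)//; near: z.
have /is_derive_mxP dXij := derivableP dX.
have ddet : derivable (fun z => \det (X z)) y v.
  by case: (is_derive_det (derivableP dX)).
apply/derivable_mxP => i j; under eq_fun do rewrite !mxE.
apply: derivableM.
  apply: derivableV => //; have := nbhs_singleton Xu.
  by rewrite unitmxE unitfE.
rewrite /cofactor; apply: derivableM; first exact: derivable_cst.
have : is_derive y v (fun z => row' j (col' i (X z))) (row' j (col' i ('D_v X y))).
  apply/is_derive_mxP => a b; under eq_fun do rewrite !mxE.
  by rewrite !mxE; exact: dXij.
by move=> /is_derive_det[].
Unshelve. all: by end_near. Qed.

End DirectionalDerivatives.

Lemma derive_sum_delta (R : realType) (n : nat) (W : normedModType R)
    (f : 'rV[R]_n -> W) (y v : 'rV[R]_n) : differentiable f y ->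
  'D_v f y = \sum_b v 0 b *: 'D_(delta_mx 0 b) f y.
Proof.
move=> df; rewrite deriveE// {1}(row_sum_delta v) linear_sum/=.
by apply: eq_bigr => b _; rewrite linearZ/= deriveE.
Qed.

Section Differentiability.
Variables (R : realType) (V : normedModType R) (y : V).

Lemma differentiable_sum_seq (I : Type) (r : seq I) (P : pred I) (f : I -> V -> R) :
  (forall i, differentiable (f i) y) ->
  differentiable (fun z => \sum_(i <- r | P i) f i z) y.
Proof.
move=> df; elim: r => [|i r IH].
  by under eq_fun do rewrite big_nil; exact: differentiable_cst.
under eq_fun do rewrite big_cons.
by case: (P i) => //; apply: differentiableD.
Qed.

Lemma differentiable_prod_seq (I : Type) (r : seq I) (P : pred I) (f : I -> V -> R) :
  (forall i, differentiable (f i) y) ->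
  differentiable (fun z => \prod_(i <- r | P i) f i z) y.
Proof.
move=> df; elim: r => [|i r IH].
  by under eq_fun do rewrite big_nil; exact: differentiable_cst.
under eq_fun do rewrite big_cons.
by case: (P i) => //; apply: differentiableM.
Qed.

Lemma differentiable_entry (m n : nat) (X : V -> 'M[R]_(m, n)) i j :
  differentiable X y -> differentiable (fun z => X z i j) y.
Proof.
move=> dX.
exact: (differentiable_comp dX (differentiable_coord (X y) i j)).
Qed.

End Differentiability.

(** * Symmetry of second derivatives *)

Section Schwarz.
Variables (R : realType) (V : normedModType R).
Implicit Types (f g p q : V -> R) (y v w : V).

(** The mean value theorem is applied twice: along [v] to the difference [phi] of two translates of
    [f], then along [w] to [g]. *)
Lemma mixed_difference f g p y v w (s t : R) : 0 < s -> 0 < t ->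
  (forall a b : R, 0 <= a <= s -> 0 <= b <= t ->
     is_derive (a *: v + (b *: w + y)) v f (g (a *: v + (b *: w + y))) /\
     is_derive (a *: v + (b *: w + y)) w g (p (a *: v + (b *: w + y)))) ->
  exists a b : R, [/\ 0 <= a <= s, 0 <= b <= t &
    f (s *: v + (t *: w + y)) - f (s *: v + y) - f (t *: w + y) + f y =
    p (a *: v + (b *: w + y)) * t * s].
Proof.
move=> s0 t0 H.
have y0 : y = 0 *: w + y by rewrite scale0r add0r.
pose phi (x : R) : R := f (x *: v + (t *: w + y)) - f (x *: v + y).
pose dphi (x : R) : R := g (x *: v + (t *: w + y)) - g (x *: v + y).
have dphiP (x : R) : 0 <= x <= s -> is_derive x 1 phi (dphi x).
  move=> xs.
  have [fx _] := H x t xs (introT andP (conj (ltW t0) (lexx t))).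
  have [fx0 _] := H x 0 xs (introT andP (conj (lexx 0) (ltW t0))).
  rewrite -y0 in fx0.
  exact: (is_deriveB ((is_derive_line _ _ _ _ _).1 fx) ((is_derive_line _ _ _ _ _).1 fx0)).
have [a] : exists2 a, a \in `]0, s[ & phi s - phi 0 = dphi a * (s - 0).
  apply: MVT => //.
    by move=> x; rewrite in_itv/= => /andP[x0 xs]; apply: dphiP; rewrite !ltW.
  apply: derivable_within_continuous => x; rewrite in_itv/= => xs.
  by case: (dphiP x xs).
rewrite in_itv/= => /andP[a0 /ltW ats] phiE; have {}ats : 0 <= a <= s by rewrite ltW.
pose psi (z : R) : R := g (a *: v + (z *: w + y)).
pose dpsi (z : R) : R := p (a *: v + (z *: w + y)).
have dpsiP (z : R) : 0 <= z <= t -> is_derive z 1 psi (dpsi z).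
  move=> zt; have [_ d] := H a z ats zt.
  have -> : psi = fun x => g (x *: w + (a *: v + y)).
    by apply/funext => x; rewrite /psi addrCA.
  rewrite addrCA in d; rewrite /dpsi addrCA.
  exact: ((is_derive_line _ _ _ _ _).1 d).
have [b] : exists2 b, b \in `]0, t[ & psi t - psi 0 = dpsi b * (t - 0).
  apply: MVT => //.
    by move=> x; rewrite in_itv/= => /andP[x0 xs]; apply: dpsiP; rewrite !ltW.
  apply: derivable_within_continuous => x; rewrite in_itv/= => xs.
  by case: (dpsiP x xs).
rewrite in_itv/= => /andP[b0 /ltW bt] psiE.
exists a, b; split=> //; first by rewrite ltW.
rewrite subr0 in psiE; rewrite -/(dpsi b) -psiE /psi -y0.
move: phiE; rewrite subr0 -/(dphi a) => <-.
rewrite /phi scale0r !add0r.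
by move: (f _) (f _) (f _) (f _) => A B C D; rewrite opprB addrA addrAC.
Qed.

(** The second difference is symmetric in [v] and [w], so [p] and [q] take a common value at two
    points arbitrarily close to [y]; continuity at [y] concludes. *)
Lemma mixed_derivatives_eq f g1 g2 p q y v w :
  (\forall z \near y, [/\ is_derive z v f (g1 z), is_derive z w f (g2 z),
     is_derive z w g1 (p z) & is_derive z v g2 (q z)]) ->
  {for y, continuous p} -> {for y, continuous q} -> p y = q y.
Proof.
move=> fy cp cq.
apply/eqP; rewrite -subr_eq0 -normr_le0; apply/ler_addgt0Pr => e e0; rewrite add0r.
have e20 : 0 < e / 2 by rewrite divr_gt0.
have cp' : \forall z \near y, `|p y - p z| < e / 2.
  by move/cvgrPdist_lt : cp; exact.
have cq' : \forall z \near y, `|q y - q z| < e / 2.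
  by move/cvgrPdist_lt : cq; exact.
have [r /= r0 Hr] := (nbhs_ballP _ _).1 (filterI fy (filterI cp' cq')).
(* The step [d] below keeps the parallelogram spanned by [d *: v] and [d *: w] at [y] inside the
   ball of radius [r]; the summand 1 makes [M] positive even when both vectors are 0. *)
pose M := `|v| + `|w| + 1.
have M0 : 0 < M by rewrite ltr_wpDl// addr_ge0.
pose d := r / 2 / M.
have d0 : 0 < d by rewrite !divr_gt0.
have Hd a b : 0 <= a <= d -> 0 <= b <= d -> ball y r (a *: v + (b *: w + y)).
  move=> /andP[a0 ad] /andP[b0 bd]; rewrite -ball_normE/= addrA opprD addrCA subrr addr0.
  rewrite normrN (le_lt_trans (ler_normD _ _))// !normrZ !ger0_norm//.
  apply: (@le_lt_trans _ _ (d * M)).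
    rewrite /M mulrDr mulr1; apply: ler_wpDr; first exact: ltW.
    by rewrite mulrDr; apply: lerD; rewrite ler_wpM2r.
  by rewrite /d divfK ?lt0r_neq0// ltr_pdivrMr// ltr_pMr// ltr1n.
have [|a [b [ad bd abE]]] := @mixed_difference f g1 p y v w d d d0 d0.
  by move=> a b ad bd; have [[]] := Hr _ (Hd a b ad bd).
have [|b' [a' [bd' ad' abE']]] := @mixed_difference f g2 q y w v d d d0 d0.
  by move=> b' a' bd' ad'; rewrite addrCA; have [[]] := Hr _ (Hd a' b' ad' bd').
have pq : p (a *: v + (b *: w + y)) = q (a' *: v + (b' *: w + y)).
  apply: (mulIf (lt0r_neq0 d0)); apply: (mulIf (lt0r_neq0 d0)).
  rewrite -abE [a' *: v + _]addrCA -abE' [d *: w + (d *: v + y)]addrCA.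
  by congr (_ + _); rewrite addrAC.
have [_ [Pd _]] := Hr _ (Hd a b ad bd).
have [_ [_ Qd]] := Hr _ (Hd a' b' ad' bd').
rewrite (splitr e) -(subrKA (p (a *: v + (b *: w + y)))).
by rewrite (le_trans (ler_normD _ _))// lerD ?ltW// pq distrC.
Qed.

End Schwarz.

(** * Closedness and the divergence of the cofactors *)

Section DivergenceFree.
Variables (R : realType) (p k : nat).
Local Notation n := (p + k)%N.

(* [b v U] stands for the derivative along [v] of a closed form at [U]. *)
Lemma closed_alternating_swap (r m : nat) (b : 'rV[R]_r -> 'M[R]_(m, r) -> R) :
  (forall v (s : 'S_m) U, b v (row_perm s U) = (-1) ^+ s * b v U) ->
  (forall V : 'M[R]_(m.+1, r), \sum_(l < m.+1) (-1) ^+ l * b (row l V) (row' l V) = 0) ->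
  forall v U, b v U = \sum_(l < m) b (row l U) (set_row l v U).
Proof.
move=> balt bcl v U.
pose V : 'M[R]_(m.+1, r) := \matrix_(i, j)
  if unlift ord0 i is Some l then U l j else v 0 j.
have V0 j : V ord0 j = v 0 j by rewrite mxE unlift_none.
have VS l j : V (lift ord0 l) j = U l j by rewrite mxE liftK.
clearbody V; have := bcl V; rewrite big_ord_recl expr0 mul1r.
have -> : row ord0 V = v by apply/rowP => j; rewrite mxE.
have -> : row' ord0 V = U by apply/matrixP => i j; rewrite mxE.
move=> /eqP; rewrite addr_eq0 => /eqP ->; rewrite -sumrN; apply: eq_bigr => l _.
have -> : row (lift ord0 l) V = row l U by apply/rowP => j; rewrite !mxE.
case: m U V V0 VS l b balt bcl => [|m] U V V0 VS l b balt bcl; first by case: l.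
(* Omitting row [l + 1] leaves [v] on top; the cycle that moves it to slot [l] has sign (-1)^l,
   which against (-1)^(l+1) leaves -1. *)
have -> : row' (lift ord0 l) V = row_perm (lift_perm ord0 l 1) (set_row l v U).
  apply/matrixP => i j; rewrite !mxE.
  case: (unliftP ord0 i) => [i'|] ->.
    rewrite lift_perm_lift perm1 eq_sym (negPf (neq_lift _ _)).
    have -> : lift (lift ord0 l) (lift ord0 i') = lift ord0 (lift l i').
      by apply/val_inj; rewrite /= /bump /=; lia.
    exact: VS.
  rewrite lift_perm_id eqxx.
  have -> : lift (lift ord0 l) ord0 = ord0 by exact/val_inj.
  exact: V0.
rewrite balt odd_lift_perm odd_perm1 addbF /= signr_odd mulrA -exprD.
have -> : (bump 0 l + l)%N = (l + l).+1 by rewrite /bump; lia.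
by rewrite -signr_odd/= addnn odd_double expr1 mulN1r opprK.
Qed.

(** This is the part of the divergence in which the derivative falls on the closed form. [Q] stands
    for the remaining factors, which do not change when slot [c] is exchanged with a slot of the
    form. *)
Lemma signed_sum_closed_eq0 (b : 'rV[R]_n -> 'M[R]_(p, n) -> R) (c : 'I_k)
    (Q : 'S_n -> R) :
  (forall v (s : 'S_p) U, b v (row_perm s U) = (-1) ^+ s * b v U) ->
  (forall V : 'M[R]_(p.+1, n), \sum_(l < p.+1) (-1) ^+ l * b (row l V) (row' l V) = 0) ->
  (forall (l : 'I_p) s, Q (tperm (lshift k l) (rshift p c) * s)%g = Q s) ->
  \sum_(s : 'S_n) (-1) ^+ s *
    (b (delta_mx 0 (s (rshift p c))) (usubmx (perm_mx s)) * Q s) = 0.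
Proof.
move=> balt bcl QE; set rc := rshift p c.
pose B (s : 'S_n) := b (delta_mx 0 (s rc)) (usubmx (perm_mx s)).
set S := \sum_(_ : _) _.
(* Closedness expresses each term by [p] terms with the sign reversed, so
   [S = - p S]. *)
have BE s : B s = \sum_(l < p) B (tperm (lshift k l) rc * s)%g.
  rewrite {1}/B (closed_alternating_swap balt bcl); apply: eq_bigr => l _.
  rewrite /B; congr (b _ _).
    by apply/rowP => j; rewrite !mxE eqxx permM tpermR eq_sym.
  apply/matrixP => i j; rewrite !mxE permM.
  have [->|il] := eqVneq i l; first by rewrite tpermL eqxx eq_sym.
  by rewrite tpermD// ?eq_rlshift// (inj_eq (@lshift_inj _ _)) eq_sym.
have SE : S = \sum_(l < p) (- S).
  transitivity (\sum_(l < p) \sum_(s : 'S_n) (-1) ^+ s *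
      (B (tperm (lshift k l) rc * s)%g * Q s)).
    rewrite exchange_big/=; apply: eq_bigr => s _; rewrite -/(B s) {1}BE.
    by rewrite mulr_suml mulr_sumr.
  apply: eq_bigr => l _; rewrite /S [in RHS](reindex_inj (mulgI (tperm (lshift k l) rc))) /=.
  rewrite -sumrN; apply: eq_bigr => s _; rewrite -/(B _) QE odd_permM odd_tperm.
  by rewrite signr_addb eq_lrshift expr1 mulN1r mulNr opprK.
move: SE; rewrite sumr_const card_ord mulNrn => /eqP; rewrite -addr_eq0 -mulrS.
by rewrite mulrn_eq0/= => /eqP.
Qed.

Variables (al : 'rV[R]_n -> 'M[R]_(p, n) -> R) (J : 'rV[R]_n -> 'M[R]_(n, k)).
Variable (y : 'rV[R]_n).
Hypothesis al_diff : forall V, differentiable (al ^~ V) y.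
Hypothesis al_alt : forall v (s : 'S_p) V,
  'D_v (al ^~ (row_perm s V)) y = (-1) ^+ s * 'D_v (al ^~ V) y.
Hypothesis al_closed : forall V : 'M[R]_(p.+1, n),
  \sum_(l < p.+1) (-1) ^+ l * 'D_(row l V) (al ^~ (row' l V)) y = 0.
Hypothesis J_diff : forall i c, differentiable (fun z => J z i c) y.
Hypothesis J_sym : forall i j c,
  'D_(delta_mx 0 i) (fun z => J z j c) y = 'D_(delta_mx 0 j) (fun z => J z i c) y.

Lemma differentiable_wedge_cofactor i c :
  differentiable (fun z => wedge_cofactor (al z) (J z) i c) y.
Proof.
under eq_fun do rewrite mxE.
apply: differentiable_sum_seq => s.
apply: differentiableM; first exact: differentiable_cst.
apply: differentiableM; last exact: differentiable_prod_seq.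
by apply: differentiableM => //; exact: differentiable_cst.
Qed.

(** The product rule splits the divergence. Terms that differentiate [al] vanish by closedness.
    Terms that differentiate [J] cancel in pairs: exchanging the slots [c] and [e] reverses the sign
    and, by [J_sym], preserves the rest. *)
Lemma wedge_cofactor_div_free c :
  \sum_i 'D_(delta_mx 0 i) (fun z => wedge_cofactor (al z) (J z) i c) y = 0.
Proof.
pose P (s : 'S_n) := \prod_(d | d != c) J y (s (rshift p d)) d.
pose dP i (s : 'S_n) e := 'D_(delta_mx 0 i) (fun z => J z (s (rshift p e)) e) y *
  \prod_(d | (d != c) && (d != e)) J y (s (rshift p d)) d.
have D i : 'D_(delta_mx 0 i) (fun z => wedge_cofactor (al z) (J z) i c) y =
    \sum_(s : 'S_n) (-1) ^+ s * ((s (rshift p c) == i)%:R *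
     ('D_(delta_mx 0 i) (al ^~ (usubmx (perm_mx s))) y * P s +
      al y (usubmx (perm_mx s)) * \sum_(e | e != c) dP i s e)).
  apply: derive_val; under eq_fun do rewrite mxE.
  apply: is_derive_sum_seq => s; move: ((s (rshift p c) == i)%:R : R) => x5.
  have dal : is_derive y (delta_mx 0 i) (al ^~ (usubmx (perm_mx s)))
      ('D_(delta_mx 0 i) (al ^~ (usubmx (perm_mx s))) y).
    exact/derivableP/diff_derivable.
  have dJ : is_derive y (delta_mx 0 i)
      (fun z => \prod_(d | d != c) J z (s (rshift p d)) d) (\sum_(e | e != c) dP i s e).
    by apply: is_derive_prod => d; apply/derivableP/diff_derivable.
  have dc (x : R) := is_derive_cst x y (delta_mx 0 i : 'rV[R]_n).
  apply: (is_derive_eq (is_derive_mul (dc _) (is_derive_mul (is_derive_mul dal (dc x5)) dJ))).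
  rewrite mul0r add0r mulr0 addr0 -/(P s) /cst; congr (_ * _).
  move: ('D_ _ _ _) (al y _) (P s) (\sum_(_ | _) _) => x1 x2 x3 x4.
  by ring.
under eq_bigr do rewrite D.
rewrite exchange_big/=.
have -> : \sum_(s : 'S_n) \sum_i (-1) ^+ s * ((s (rshift p c) == i)%:R *
     ('D_(delta_mx 0 i) (al ^~ (usubmx (perm_mx s))) y * P s +
      al y (usubmx (perm_mx s)) * \sum_(e | e != c) dP i s e)) =
   \sum_(s : 'S_n) (-1) ^+ s *
     ('D_(delta_mx 0 (s (rshift p c))) (al ^~ (usubmx (perm_mx s))) y * P s) +
   \sum_(e | e != c) \sum_(s : 'S_n) (-1) ^+ s *
      (al y (usubmx (perm_mx s)) * dP (s (rshift p c)) s e).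
  rewrite [X in _ + X]exchange_big -big_split/=; apply: eq_bigr => s _.
  rewrite (bigD1 (s (rshift p c)))//= [X in _ + X = _]big1 ?addr0 => [|i /negPf]; last first.
    by rewrite eq_sym => ->; rewrite mul0r mulr0.
  by rewrite eqxx mul1r mulrDr; congr (_ + _); rewrite !mulr_sumr.
rewrite (signed_sum_closed_eq0 (b := fun v V => 'D_v (al ^~ V) y))//; last first.
  move=> l s; apply: eq_bigr => d dc; rewrite permM tpermD// ?eq_lrshift//.
  by rewrite (inj_eq (@rshift_inj _ _)) eq_sym.
rewrite add0r big1// => e ec.
apply: (@signed_sum_tperm_eq0 _ _ (rshift p c) (rshift p e)).
  by rewrite (inj_eq (@rshift_inj _ _)) eq_sym.
move=> s; congr (_ * _).
  by congr (al _ _); apply/matrixP => l j; rewrite !mxE permM tpermD// eq_rlshift.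
rewrite /dP !permM tpermL tpermR J_sym; congr (_ * _).
apply: eq_bigr => d /andP[dc de].
by rewrite permM tpermD// (inj_eq (@rshift_inj _ _)) eq_sym.
Qed.

End DivergenceFree.

(** * Differentiating the first cousin identity in a chart *)

Lemma sum_frame_derivative_local (R : realType) (n k : nat) (y : 'rV[R]_n)
    (f : 'rV[R]_n -> 'rV[R]_k) (H : 'rV[R]_n -> 'M[R]_n) (G : 'rV[R]_k -> 'M[R]_k)
    (Gf : 'rV[R]_n -> 'M[R]_k) (A Psi : 'rV[R]_n -> 'M[R]_(n, k)) (K mu : R)
    (E : 'M[R]_n) :
  differentiable f y -> differentiable H y -> differentiable G (f y) ->
  (\forall z \near y, Gf z = G (f z)) ->
  (forall i c, differentiable (fun z => Psi z i c) y) ->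
  (forall c, \sum_i 'D_(delta_mx 0 i) (fun z => Psi z i c) y = 0) ->
  0 < K ->
  (\forall z \near y, [/\ posdef_mx (H z), posdef_mx (Gf z) &
     A z *m Gf z =
     (Num.sqrt (\det (Gf z)) / (K * Num.sqrt (\det (H z)))) *: (H z *m Psi z)]) ->
  (jacobian f y)^T *m invmx (H y) *m A y = mu *: invmx (Gf y) ->
  E *m H y *m E^T = 1%:M ->
  \sum_l row l E *m 'D_(row l E) A y =
    contracted_christoffel (H y) (fun b => 'D_(delta_mx 0 b) H y) *m A y
    - mu *: contracted_christoffel (Gf y) (fun d => 'D_(delta_mx 0 d) G (f y)).
Proof.
move=> fd Hd Gd GfE Psid divPsi K0 AE conf Eon.
pose rho z := Num.sqrt (\det (Gf z)) / (K * Num.sqrt (\det (H z))).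
have [Hy Gy Ay] := nbhs_singleton AE.
have hu := posdef_unitmx Hy; have gu := posdef_unitmx Gy.
have dPsi v : is_derive y v Psi (\matrix_(i, c) 'D_v (fun z => Psi z i c) y).
  by apply/is_derive_mxP => i c; rewrite mxE; exact/derivableP/diff_derivable.
have dH v : is_derive y v H ('D_v H y) by exact/derivableP/diff_derivable.
have dGf v : is_derive y v Gf ('D_(v *m jacobian f y) G (f y)).
  apply: (@near_eq_is_derive _ _ _ (G \o f)); first by near do apply/esym.
  have dGof : differentiable (G \o f) y by exact: differentiable_comp.
  have <- : 'D_v (G \o f) y = 'D_(v *m jacobian f y) G (f y).
    rewrite (deriveE _ dGof) (diff_comp fd Gd) (deriveE _ Gd).
    by rewrite -(deriveEjacobian _ fd) (deriveE _ fd).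
  exact: (derivableP (diff_derivable dGof)).
have drho v : is_derive y v rho (rho y *
    (2^-1 * \tr (invmx (Gf y) *m 'D_(v *m jacobian f y) G (f y))
     - 2^-1 * \tr (invmx (H y) *m 'D_v H y))).
  have dG := is_derive_sqrt_det (dGf v) (posdef_det_gt0 Gy).
  have dh := is_derive_sqrt_det (dH v) (posdef_det_gt0 Hy).
  have sG : 0 < Num.sqrt (\det (Gf y)) by rewrite sqrtr_gt0 posdef_det_gt0.
  have sH : 0 < Num.sqrt (\det (H y)) by rewrite sqrtr_gt0 posdef_det_gt0.
  have dKh := is_derive_mul (is_derive_cst K y v) dh.
  have KH0 : K * Num.sqrt (\det (H y)) != 0 by rewrite mulf_neq0 ?lt0r_neq0.
  have dV : is_derive y v (fun z => (K * Num.sqrt (\det (H z)))^-1)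
      (- (K * Num.sqrt (\det (H y))) ^- 2 *:
        (0 * Num.sqrt (\det (H y)) + K * (Num.sqrt (\det (H y)) *
          (2^-1 * \tr (invmx (H y) *m 'D_v H y))))).
    have [d1 d2] := dKh; split; first exact: derivableV.
    by rewrite deriveV// d2.
  apply: (is_derive_eq (is_derive_mul dG dV)); rewrite /rho.
  move: (\tr _) (\tr _) sG sH KH0 => t1 t2.
  move: (Num.sqrt _) (Num.sqrt _) => s1 s2 s10 s20 KH0.
  rewrite /GRing.scale/= mul0r add0r; field.
  by rewrite !lt0r_neq0.
(* Derivability of [A] is obtained by solving the identity for it near [y]. This covers the zeros of
   the differential, where the norm itself need not be derivable. *)
have dA v : derivable A y v.
  apply: (@near_eq_derivable _ _ _ (fun z => rho z *: (H z *m Psi z *m invmx (Gf z)))).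
    near=> z.
    have [_ Gz AzE] : [/\ posdef_mx (H z), posdef_mx (Gf z) &
     A z *m Gf z = rho z *: (H z *m Psi z)] by near: z.
    by rewrite scalemxAl -AzE mulmxK// posdef_unitmx.
  have dinv : derivable (fun z => invmx (Gf z)) y v.
    apply: derivable_invmx; first by case: (dGf v).
    by near=> z; apply: posdef_unitmx; near: z; apply: filterS AE => z [].
  by case: (is_derive_scalemx (drho v)
    (is_derive_mulmx (is_derive_mulmx (dH v) (dPsi v)) (derivableP dinv))).
apply: (@sum_frame_derivative _ _ _ (H y) (Gf y) E (A y) (jacobian f y) (Psi y)
  (rho y) mu _ _ (fun b => \matrix_(i, c) 'D_(delta_mx 0 b) (fun z => Psi z i c) y)
  (fun v => 'D_v A y)) => //.
- apply: (can_inj (mulmxK hu)); rewrite mulVmx// -mulmxA.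
  exact: mulmx1C.
- apply/rowP => c; rewrite summxE mxE -[RHS](divPsi c); apply: eq_bigr => b _.
  by rewrite !mxE.
move=> v x.
have d1 := is_derive_mulmx (derivableP (dA v)) (dGf v).
have d2 := is_derive_scalemx (drho v) (is_derive_mulmx (dH v) (dPsi v)).
have : is_derive y v (fun z => A z *m Gf z)
    (rho y * (2^-1 * \tr (invmx (Gf y) *m 'D_(v *m jacobian f y) G (f y))
     - 2^-1 * \tr (invmx (H y) *m 'D_v H y)) *: (H y *m Psi y) +
     rho y *: ('D_v H y *m Psi y + H y *m \matrix_(i, c) 'D_v (fun z => Psi z i c) y)).
  apply: near_eq_is_derive d2; near=> z; apply/esym.
  by have [] : [/\ posdef_mx (H z), posdef_mx (Gf z) &
     A z *m Gf z = rho z *: (H z *m Psi z)] by near: z.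
case=> _; have [_ ->] := d1 => e.
have GfD : 'D_(v *m jacobian f y) G (f y) =
    \sum_d (v *m jacobian f y) 0 d *: 'D_(delta_mx 0 d) G (f y).
  exact: derive_sum_delta.
have HD : 'D_v H y = \sum_b v 0 b *: 'D_(delta_mx 0 b) H y.
  exact: derive_sum_delta.
have PD : \matrix_(i, c) 'D_v (fun z => Psi z i c) y = \sum_b v 0 b *:
    \matrix_(i, c) 'D_(delta_mx 0 b) (fun z => Psi z i c) y.
  apply/matrixP => i c; rewrite mxE summxE derive_sum_delta//.
  by apply: eq_bigr => b _; rewrite !mxE.
rewrite -GfD -HD -PD e; congr (_ *: _ + _); congr (_ * _); rewrite /x; congr (_ - _);
  congr (_ * _).
- rewrite GfD mulmx_sumr raddf_sum/=; apply: eq_bigr => d _.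
  by rewrite -scalemxAr mxtraceZ.
- rewrite HD mulmx_sumr raddf_sum/=; apply: eq_bigr => d _.
  by rewrite -scalemxAr mxtraceZ.
Unshelve. all: by end_near. Qed.

Lemma smooth_on_partials_comm (R : realType) (n k : nat) (U : set 'rV[R]_n)
    (f : 'rV[R]_n -> 'rV[R]_k) (y : 'rV[R]_n) (a b : 'I_n) (c : 'I_k) :
  smooth_on U f -> nbhs y U ->
  'D_(delta_mx 0 a) (fun z => ('D_(delta_mx 0 b) f z) 0 c) y =
  'D_(delta_mx 0 b) (fun z => ('D_(delta_mx 0 a) f z) 0 c) y.
Proof.
move=> sf Uy.
have d1 z e : U z -> is_derive z (delta_mx 0 e) (fun z => f z 0 c)
    (('D_(delta_mx 0 e) f z) 0 c).
  move=> Uz.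
  have /is_derive_mxP := derivableP (diff_derivable (v := delta_mx 0 e) (sf [::] z Uz)).
  exact.
have d2 z e e' : U z ->
    is_derive z (delta_mx 0 e') (fun z => ('D_(delta_mx 0 e) f z) 0 c)
     (('D_(delta_mx 0 e') ('D_(delta_mx 0 e) f) z) 0 c).
  move=> Uz.
  have /is_derive_mxP := derivableP (diff_derivable (v := delta_mx 0 e') (sf [:: e] z Uz)).
  exact.
have Uy0 := nbhs_singleton Uy.
have [_ ->] := d2 y b a Uy0; have [_ ->] := d2 y a b Uy0.
have cont e e' : {for y, continuous
    (fun z => ('D_(delta_mx 0 e') ('D_(delta_mx 0 e) f) z) 0 c : R)}.
  apply: differentiable_continuous; apply: differentiable_entry.
  exact: (sf [:: e'; e] y Uy0).
apply: (@mixed_derivatives_eq _ _ (fun z => f z 0 c)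
  (fun z => ('D_(delta_mx 0 b) f z) 0 c) (fun z => ('D_(delta_mx 0 a) f z) 0 c)
  (fun z => ('D_(delta_mx 0 a) ('D_(delta_mx 0 b) f) z) 0 c)
  (fun z => ('D_(delta_mx 0 b) ('D_(delta_mx 0 a) f) z) 0 c)
  y (delta_mx 0 b) (delta_mx 0 a)) => //.
by apply: filterS Uy => z Uz; split; [exact: d1|exact: d1|exact: d2|exact: d2].
Qed.

Lemma jacobianE (R : realType) (n k : nat) (f : 'rV[R]_n -> 'rV[R]_k)
    (y : 'rV[R]_n) : differentiable f y ->
  jacobian f y = \matrix_(i, c) ('D_(delta_mx 0 i) f y) 0 c.
Proof.
move=> fd; apply/matrixP => i c; rewrite [RHS]mxE deriveEjacobian//.
by rewrite -rowE [RHS]mxE.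
Qed.

(** * The tension in charts *)

Section ChartNeighborhood.
Variables (R : realType) (n k : nat).
Variables (M : oriented_manifold R n) (L : oriented_manifold R k).

(** Identities in the charts are going to be differentiated, so they must hold on a whole
    neighborhood of the point. *)
Lemma near_chart (u : M -> L) (i : chart M) (j : chart L) (x : M) :
  continuous u -> dom i x -> dom j (u x) ->
  \forall y \near coord i x, (coord i @` (dom i `&` u @^-1` dom j)) y.
Proof.
move=> uc xi uxj.
have im : (coord i @` dom i) (coord i x) by exists x.
have near1 : \forall y \near coord i x, (coord i @` dom i) y.
  by apply: open_nbhs_nbhs; split=> //; exact: img_open.
have near2 : \forall y \near coord i x, dom j (u (param i y)).
  have pc := param_continuous im.
  apply: (pc (fun x => dom j (u x))); rewrite coordK//.
  apply: uc; apply: open_nbhs_nbhs; split=> //; exact: dom_open.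
near=> y.
have [z zi zy] : (coord i @` dom i) y by near: y.
exists z => //; split=> //=.
have : dom j (u (param i y)) by near: y.
by rewrite -zy coordK.
Unshelve. all: by end_near. Qed.

End ChartNeighborhood.

Lemma smith_submersion_k_harmonic (R : realType) (p k n : nat) (pkn : (p + k)%N = n)
    (M : oriented_manifold R n) (L : oriented_manifold R k)
    (h : riemannian_metric M) (g : riemannian_metric L)
    (alpha : diff_form M p) (u : M -> L) : (1 < k)%N ->
  calibration h alpha -> smith_submersion h g pkn alpha u -> closed_form alpha ->
  k_harmonic h g u.
Proof.
(* Replacing [n] by [p + k] makes the cast in the Smith equation trivial. *)
case: n / pkn M h alpha u => M h alpha u k1 cal [[uc us] _ smith] closed.
move=> i j x xi uxj E Eon.
pose y := coord i x; pose f := coord j \o u \o param i.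
pose O := coord i @` (dom i `&` u @^-1` dom j).
have Oy : nbhs y O by exact: near_chart.
have Oy0 := nbhs_singleton Oy.
have px : param i y = x by exact: coordK.
have fy : f y = coord j (u x) by rewrite /f /= px.
have yi : (coord i @` dom i) y by exists x.
have sf : smooth_on O f := us i j.
have fd z (Oz : O z) : differentiable f z := sf [::] z Oz.
pose H z := h i (param i z); pose G := g j \o param j.
pose Gf z := g j (u (param i z)).
(* [smooth_on] controls iterated partial derivatives, so [J] is written with them; it agrees with
   the differential on [O]. *)
pose J z : 'M[R]_(p + k, k) := \matrix_(i, c) ('D_(delta_mx 0 i) f z) 0 c.
pose al z := alpha i (param i z).
pose Psi z := wedge_cofactor (al z) (J z).
pose A z := norm_du h g u i j (param i z) ^+ (k - 2) *: differential u i j (param i z).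
pose K : R := p`!%:R * (Num.sqrt k%:R ^+ k)^-1 * k%:R.
have K0 : 0 < K.
  rewrite /K !mulr_gt0 ?invr_gt0 ?exprn_gt0 ?sqrtr_gt0 ?ltr0n ?fact_gt0//; exact: ltnW.
have metricP z : O z -> posdef_mx (H z) /\ posdef_mx (Gf z).
  move=> [z' [z'i uz'] <-]; rewrite /H /Gf coordK//; split; split.
  - exact: metric_sym.
  - exact: metric_posdef.
  - exact: metric_sym.
  - exact: metric_posdef.
have diffJ z : O z -> differential u i j (param i z) = J z.
  move=> Oz; have [z' [z'i _] zz'] := Oz.
  rewrite /differential -[in param i z]zz' coordK// zz'.
  exact/jacobianE/fd.
have first_order z : O z ->
    Num.sqrt (\det (Gf z)) *: Psi z =
    (K * norm_du h g u i j (param i z) ^+ (k - 2) * Num.sqrt (\det (H z))) *: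
      (invmx (H z) *m J z *m Gf z).
  move=> Oz; have [Hz Gz] := metricP z Oz; have dJ := diffJ z Oz.
  have [z' [z'i uz'] zz'] := Oz.
  have pz : param i z = z' by rewrite -zz' coordK.
  rewrite /norm_du /pullback_metric dJ.
  apply: first_cousin => //.
  - by rewrite /al pz; exact: form_multilinear.
  - by move=> W; rewrite /al /H pz; exact: cal.
  (* The Smith equation is taken at the coordinate frame and multiplied by p! to pass to
     [wedge_pullback]. *)
  have := smith i j z' z'i uz' 1%:M; rewrite castmx_id.
  rewrite -pz dJ /norm_du /pullback_metric dJ /volume_form det1 mulr1.
  have -> : wedge_form (alpha i (param i z))
      (fun W => Num.sqrt (\det (g j (u (param i z)))) * \det (W *m J z)) 1%:M =
      Num.sqrt (\det (Gf z)) * ((p`!%:R)^-1 * wedge_pullback (al z) (J z) 1%:M).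
    rewrite -wedge_form_det /wedge_form mulrCA; congr (_ * _).
    by rewrite mulr_sumr; apply: eq_bigr => s _; rewrite mulrCA.
  have p0 : p`!%:R != 0 :> R by rewrite pnatr_eq0 -lt0n fact_gt0.
  rewrite mulrCA => /(congr1 ( *%R p`!%:R)); rewrite mulVKf// => ->.
  by rewrite !mulrA.
have AG z : O z -> A z *m Gf z =
    (Num.sqrt (\det (Gf z)) / (K * Num.sqrt (\det (H z)))) *: (H z *m Psi z).
  move=> Oz; have [Hz Gz] := metricP z Oz.
  have sH : 0 < Num.sqrt (\det (H z)) by rewrite sqrtr_gt0 posdef_det_gt0.
  rewrite mulrC -scalerA scalemxAr first_order// -scalemxAr -mulmxA mulKVmx ?posdef_unitmx//.
  rewrite /A diffJ// -scalemxAl scalerA; congr (_ *: _).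
  move: (norm_du _ _ _ _ _ _ ^+ _) (Num.sqrt _) sH => N s s0.
  by field; rewrite !lt0r_neq0.
have [Hy Gy] := metricP y Oy0.
have hu := posdef_unitmx Hy; have gu := posdef_unitmx Gy.
have Jy : jacobian f y = J y by exact/jacobianE/fd.
(* The conformal factor: [J^T *m Psi] is the wedge times the identity, and the quotient is the
   factor in [AG]. *)
pose mu := Num.sqrt (\det (Gf y)) / (K * Num.sqrt (\det (H y)))
  * wedge_pullback (al y) (J y) 1%:M.
have conf : (jacobian f y)^T *m invmx (H y) *m A y = mu *: invmx (Gf y).
  apply: (can_inj (mulmxK gu)); rewrite -scalemxAl mulVmx// -!mulmxA AG//.
  rewrite -!scalemxAr mulKmx// Jy trmx_mul_wedge_cofactor scale_scalar_mx.
  by rewrite scalemx1.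
have Hd : differentiable H y := @metric_smooth _ _ _ h i [::] _ yi.
have Gd : differentiable G (f y).
  by rewrite fy; apply: (@metric_smooth _ _ _ g j [::]); exists (u x).
have ald V : differentiable (al ^~ V) y := @form_smooth _ _ _ _ alpha i V [::] _ yi.
have al_alt v (s : 'S_p) V :
    'D_v (al ^~ (row_perm s V)) y = (-1) ^+ s * 'D_v (al ^~ V) y.
  have -> : 'D_v (al ^~ (row_perm s V)) y = 'D_v (fun z => (-1) ^+ s * al z V) y.
    apply: near_eq_derive; apply: filterS Oy => z [z' [z'i _] <-].
    rewrite /al coordK//; apply: alternating_row_perm.
      exact: form_multilinear.
    exact: form_alternating.
  have d := is_derive_mul (is_derive_cst ((-1) ^+ s : R) y v)
    (derivableP (diff_derivable (v := v) (ald V))).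
  by case: d => _ ->; rewrite mul0r add0r.
have Jd a c : differentiable (fun z => J z a c) y.
  under eq_fun do rewrite mxE.
  by apply: differentiable_entry; exact: (sf [:: a] y Oy0).
have Jsym a b c : 'D_(delta_mx 0 a) (fun z => J z b c) y =
    'D_(delta_mx 0 b) (fun z => J z a c) y.
  under eq_fun do rewrite mxE; under [in RHS]eq_fun do rewrite mxE.
  exact: smooth_on_partials_comm sf Oy.
have main : \sum_l row l E *m 'D_(row l E) A y =
    contracted_christoffel (H y) (fun b => 'D_(delta_mx 0 b) H y) *m A y
    - mu *: contracted_christoffel (Gf y) (fun d => 'D_(delta_mx 0 d) G (f y)).
  apply: (@sum_frame_derivative_local _ _ _ y f H G Gf A Psi K mu E) => //.
  - exact: fd.
  - apply: filterS Oy => z [z' [z'i uz'] <-].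
    by rewrite /Gf /G /f /= !coordK.
  - by move=> a c; apply: differentiable_wedge_cofactor.
  - move=> c; apply: wedge_cofactor_div_free => // V.
    exact: closed i x xi V.
  - by apply: filterS Oy => z Oz; have [] := metricP z Oz; split=> //; exact: AG.
  - by rewrite /H px.
pose Ax := norm_du h g u i j x ^+ (k - 2) *: differential u i j x.
have AxE : Ax = A y by rewrite /A px.
have -> : k_tension h g u i j x E = \sum_l (row l E *m 'D_(row l E) A y
    - christoffel h i x (row l E) (row l E) *m Ax
    + christoffel g j (u x) (row l E *m jacobian f y) (row l E *m Ax)) by [].
(* Three sums remain: the derivative of [A] and the Christoffel terms of source and target. [main]
   equates the first with what the other two subtract. *)
rewrite {}AxE big_split/= sumrB -mulmx_suml.
have -> : \sum_l christoffel h i x (row l E) (row l E) =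
    contracted_christoffel (H y) (fun b => 'D_(delta_mx 0 b) H y).
  rewrite -[RHS]scale1r /christoffel.
  have hx : h i x = H y by rewrite /H px.
  rewrite hx.
  apply: (@sum_christoffel_formula _ _ _ (H y) _ (fun v => 'D_v H y)) => //.
  - by case: Hy.
  - by move=> v; exact: derive_sum_delta.
  rewrite scale1r; apply: (can_inj (mulmxK hu)); rewrite mulVmx// -mulmxA.
  by apply: mulmx1C; rewrite -hx.
have -> : \sum_l christoffel g j (u x) (row l E *m jacobian f y) (row l E *m A y) =
    mu *: contracted_christoffel (Gf y) (fun d => 'D_(delta_mx 0 d) G (f y)).
  have gx : g j (u x) = Gf y by rewrite /Gf px.
  rewrite /christoffel gx -fy.
  under eq_bigr do rewrite -!(row_mul _ E (jacobian f y)) -!(row_mul _ E (A y)).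
  apply: (@sum_christoffel_formula _ _ _ (Gf y) _ (fun v => 'D_v G (f y))) => //.
  - by case: Gy.
  - by move=> v; exact: derive_sum_delta.
  have EE : E^T *m E = invmx (H y).
    apply: (can_inj (mulmxK hu)); rewrite mulVmx// -mulmxA.
    by apply: mulmx1C; rewrite /H px.
  by rewrite trmx_mul -mulmxA (mulmxA E^T) EE mulmxA.
by rewrite main addrAC subrK subrr.
Qed.

Theorem theorem4p20 (R : realType) (n k : nat) (hk : (2 <= k)%N) (hkn : (k <= n)%N)
  (M : oriented_manifold R n) (L : oriented_manifold R k)
  (h : riemannian_metric M) (g : riemannian_metric L)
  (alpha : diff_form M (n - k)) (u : M -> L)
  (halpha : calibration h alpha)
  (hu : smith_submersion h g (subnK hkn) alpha u)
  (hd : closed_form alpha) :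
  k_harmonic h g u.
Proof. exact: (smith_submersion_k_harmonic hk halpha hu hd). Qed.
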